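(* Let $I$ be a finite set of players. The set $\mathbb{A}$ of absorption paths is sequentially compact: for every sequence $(\pi^k)_{k\in\mathbb{N}}$ of absorption paths there exist an absorption path $\pi$ and a subsequence, still denoted $(\pi^k)$, such that $\pi^k\Rightarrow\pi$. Moreover, this subsequence can be chosen in such a way that for every $t\in S(\pi)$ there are two sequences $(t_k)\subset[0,1]$ and $(\xi^k)\subset[0,1]^I$ with $t_k\to t$ and $\xi^k\to\xi_t$ as $k\to\infty$ such that, for every $k\in\mathbb{N}$, $t_k\in S(\pi^k)$ and $\Delta\pi^k_{t_k}(a)=(1-t_k)\,\xi^k(a)$ for all $a\in A^*$. Here $\xi_t\in[0,1]^I$ is the mixed action profile satisfying $\Delta\pi_t(a)=(1-t)\,\xi_t(a)$ for all $a\in A^*$.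
   Context: Let $I$ be a finite set of players; player $i$ has action set $A^i=\{C^i,Q^i\}$ (continue, quit). Set $A=\prod_{i\in I}A^i$, $\vec C=(C^i)_{i\in I}$, $A^*=A\setminus\{\vec C\}$, $C^{-i}=(C^j)_{j\neq i}$, $A^*_1=\{(Q^i,C^{-i}): i\in I\}$ (exactly one player quits). For $\xi\in[0,1]^I$ and $a\in A$ set $\xi(a)=\prod_{i:a^i=Q^i}\xi^i\cdot\prod_{i:a^i=C^i}(1-\xi^i)$. $\mathbf{F}$ is the set of càdlàg paths $\pi=(\pi_t(a))_{a\in A^*,\,t\in[0,1]}$ with values in $[0,1]^{A^*}$ such that $t\mapsto\pi_t(a)$ is nondecreasing for every $a\in A^*$. Weak convergence $\pi^k\Rightarrow\pi$ means $\int_{[0,1]}f(t)\,d\pi^k_t(a)\to\int_{[0,1]}f(t)\,d\pi_t(a)$ for every continuous $f:[0,1]\to\mathbb{R}$ and every $a\in A^*$; here and below $\pi_{0-}(a)=0$, so the measure $d\pi(a)$ has mass $\pi_0(a)$ at $0$. For $\pi\in\mathbf{F}$: $\widehat\pi_t=\sum_{a\in A^*}\pi_t(a)$, $\Delta\pi_t=\pi_t-\pi_{t-}$, $T(\pi)=\{t\in[0,1]:\widehat\pi_t=t\}$, $S(\pi)=\{t\in[0,1]:\Delta\pi_t\neq0\}$, and $\dot\pi_t=\liminf_{s\searrow t}\frac{\pi_s-\pi_t}{s-t}$ (coordinatewise) for $t\in[0,1)$. The set $\mathbb{A}$ of absorption paths is the set of all $\pi\in\mathbf{F}$ such that: (A.1)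 $\widehat\pi_t\ge t$ for all $t\in[0,1]$; (A.2) on each connected component $(t_1,t_2)$ of $[0,1]\setminus(S(\pi)\cup T(\pi))$, $\widehat\pi$ is constant and equal to $t_2$; and for every $t\in S(\pi)$, $\widehat\pi_t>t$ and $\widehat\pi_s=\widehat\pi_t$ for every $s\in[t,\widehat\pi_t)$; (A.3) for every $t\in S(\pi)$ there is $\xi_t\in[0,1]^I$ with $\Delta\pi_t(a)=(1-t)\,\xi_t(a)$ for all $a\in A^*$; (A.4) for every $t\in T(\pi)\setminus\{1\}$, $\dot\pi_t(a)=0$ for all $a\in A^*\setminus A^*_1$. *)

(* Defs.v *)
From HB Require Import structures.
From mathcomp Require Import all_boot all_order all_algebra.
From mathcomp Require Import all_classical all_reals all_analysis.

Set Implicit Arguments.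
Unset Strict Implicit.
Unset Printing Implicit Defensive.

Import Order.TTheory GRing.Theory Num.Def Num.Theory.
Import numFieldNormedType.Exports.

Local Open Scope classical_set_scope.
Local Open Scope ring_scope.

(* In an action profile, [true] encodes "quit" (Q^i) and [false] "continue"
   (C^i). *)
Definition profile (I : finType) := {ffun I -> bool}.

Definition all_continue (I : finType) : profile I := [ffun=> false].

Definition lone_quit (I : finType) (i : I) : profile I := [ffun j => j == i].

(* The set A^* = A \ {C}. *)
Definition absorbing (I : finType) := {a : profile I | a != all_continue I}.

(* Membership in A^*_1. *)
Definition single_quit (I : finType) (a : absorbing I) : Prop :=
  exists i : I, val a = lone_quit i.

Definition mixed_profile (R : realType) (I : finType) (xi : I -> R) : Prop :=
  forall i : I, xi i \in `[0, 1].

Definition profile_prob (R : realType) (I : finType) (xi : I -> R)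
    (a : profile I) : R :=
  (\prod_(i | a i) xi i) * (\prod_(i | ~~ a i) (1 - xi i)).

(* The set F. A path is a total function of time, but only its values on [0, 1]
   are constrained, and no definition below depends on the other values. *)
Record cadlag_path (R : realType) (I : finType) := CadlagPath {
  path_fun :> R -> absorbing I -> R ;
  path_range : forall (t : R) (a : absorbing I),
    t \in `[0, 1] -> path_fun t a \in `[0, 1] ;
  path_nondecreasing : forall (a : absorbing I) (s t : R),
    s \in `[0, 1] -> t \in `[0, 1] -> s <= t -> path_fun s a <= path_fun t a ;
  path_right_continuous : forall (a : absorbing I) (t : R),
    t \in `[0, 1[ -> path_fun s a @[s --> t^'+] --> path_fun t a ;
  path_left_limit : forall (a : absorbing I) (t : R),
    t \in `]0, 1] -> cvg (path_fun s a @[s --> t^'-])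
}.

(* Extension of t |-> pi_t(a) to the real line: 0 to the left of 0, which
   realizes the convention pi_{0-}(a) = 0, and pi_1(a) to the right of 1. *)
Definition path_ext (R : realType) (I : finType) (p : cadlag_path R I)
    (a : absorbing I) (t : R) : R :=
  if t < 0 then 0 else p (minr t 1) a.

Section PathExtCumulative.
Variables (R : realType) (I : finType) (p : cadlag_path R I) (a : absorbing I).

Let min1_itv (t : R) : 0 <= t -> minr t 1 \in `[0, 1].
Proof. by move=> t0; rewrite in_itv/= le_min t0 ler01/= ge_min lexx orbT. Qed.

Lemma path_ext_nondecreasing : nondecreasing (path_ext p a).
Proof.
move=> s t st; rewrite /path_ext; case: (ltP t 0) => t0.
  by rewrite (le_lt_trans st t0).
case: (ltP s 0) => s0.
  by have /= := path_range p a (min1_itv t0); rewrite in_itv/= => /andP[].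
apply: path_nondecreasing; [exact: min1_itv|exact: min1_itv|].
by rewrite le_min !ge_min st lexx orbT.
Qed.

Lemma path_ext_right_continuous : right_continuous (path_ext p a).
Proof.
move=> t; case: (ltP t 0) => t0.
- apply: cvg_near_cst; near=> s.
  have s0 : s < 0 by near: s; exact: nbhs_right_lt.
  by rewrite /path_ext s0 t0.
case: (ltP t 1) => t1; last first.
- apply: cvg_near_cst; near=> s.
  have ts : t < s by near: s; exact: nbhs_right_gt.
  rewrite /path_ext !ltNge t0 (le_trans t0 (ltW ts))/=.
  by rewrite !min_r// (le_trans t1 (ltW ts)).
- have -> : path_ext p a t = p t a.
    by rewrite /path_ext ltNge t0/= min_l// ltW.
  have t01 : t \in `[0, 1[ by rewrite in_itv/= t0 t1.
  apply: cvg_trans (@path_right_continuous _ _ p a t t01).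
  apply: near_eq_cvg; near=> s.
  have ts : t < s by near: s; exact: nbhs_right_gt.
  have s1 : s < 1 by near: s; exact: nbhs_right_lt.
  by rewrite /path_ext ltNge (le_trans t0 (ltW ts))/= min_l// ltW.
Unshelve. all: by end_near. Qed.

HB.instance Definition _ := isCumulative.Build R _ R (path_ext p a)
  path_ext_nondecreasing path_ext_right_continuous.

End PathExtCumulative.

Section AbsorptionPaths.
Variables (R : realType) (I : finType).
Implicit Types (p : cadlag_path R I) (a : absorbing I) (t : R).

(* The integral over [0, 1] of f d pi(a); the measure d pi(a) has mass pi_0(a)
   at 0. *)
Definition path_integral p a (f : R -> R) : R :=
  (\int[lebesgue_stieltjes_measure (path_ext p a)]_(x in `[0%R, 1%R]) f x)%R.

Definition weak_cvg (pk : nat -> cadlag_path R I) p : Prop :=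
  forall f : R -> R, {within `[0, 1], continuous f} ->
  forall a, path_integral (pk k) a f @[k --> \oo] --> path_integral p a f.

Definition path_total p t : R := \sum_(a : absorbing I) p t a.

(* pi_t(a) - pi_{t-}(a), for t in [0, 1], with pi_{0-}(a) = 0. *)
Definition path_jump p t a : R :=
  p t a - lim (path_ext p a s @[s --> t^'-]).

Definition T_set p : set R := [set t | t \in `[0, 1] /\ path_total p t = t].

Definition S_set p : set R :=
  [set t | t \in `[0, 1] /\ exists a, path_jump p t a != 0].

(* For t in [0, 1); extended-real since the difference quotients may tend to
   +oo. *)
Definition path_lower_derivative p t a : \bar R :=
  limf_einf (fun s => ((p s a - p t a) / (s - t))%:E) t^'+.

Definition jump_profile p t (xi : I -> R) : Prop :=
  mixed_profile xi /\
  forall a, path_jump p t a = (1 - t) * profile_prob xi (val a).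

Definition condA1 p : Prop := forall t, t \in `[0, 1] -> t <= path_total p t.

(* Asking components to be open intervals is no extra restriction: 0 always
   belongs to S or T, and a component ]t1, 1] with constant value 1 would put 1
   in T. *)
Definition condA2 p : Prop :=
  (forall x, (`[0, 1] `\` (S_set p `|` T_set p)) x ->
     exists t1 t2 : R,
       connected_component (`[0, 1] `\` (S_set p `|` T_set p)) x
         = (`]t1, t2[)%classic /\
       (forall s, s \in `]t1, t2[ -> path_total p s = t2)) /\
  (forall t, S_set p t ->
     t < path_total p t /\
     forall s, s \in `[0, 1] -> s \in `[t, path_total p t[ ->
       path_total p s = path_total p t).

Definition condA3 p : Prop :=
  forall t, S_set p t -> exists xi : I -> R, jump_profile p t xi.

Definition condA4 p : Prop :=
  forall t, T_set p t -> t != 1 ->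
  forall a, ~ single_quit a -> path_lower_derivative p t a = 0%E.

Definition absorption_path p : Prop :=
  [/\ condA1 p, condA2 p, condA3 p & condA4 p].

End AbsorptionPaths.

(* Main.v *)
(* Write G for the total mass of a path, extended by 0 to the negative times.
   (A.1)-(A.4) are equivalent to conditions that survive weak limits: G(1) = 1;
   t <= G(t); G is constant on [t, G(t)); (A.3); and, for every profile in
   which at least two players quit, the bound
     pi_v(a) - pi_u(a) <= (G(v) - u)^2 / (1 - v).
   The last one replaces (A.4): a jump of total size D at t has quitting
   probability D / (1 - t), so two simultaneous quits cost at most its square,
   while at times of T the increments of pi(a) are negligible with respect to
   those of G. Helly's theorem provides a convergent subsequence. A jump of the
   limit at t makes G constant on [t, G(t)); for v strictly inside, G_k(v) > v
   eventually, hence G_k reached the value G_k(v) by a jump at some t_k, and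
   t_k -> t. The jump of pi^k at t_k converges in each coordinate, because the
   left limits are bounded below coordinatewise and their sum t_k tends to t.
   The profile xi is a continuous function of the jump, being the marginals of
   its normalization. *)
Require Import Defs.
From mathcomp Require Import all_boot all_order all_algebra.
From mathcomp Require Import all_classical all_reals all_analysis.
From mathcomp Require Import ring lra.
Import Order.TTheory GRing.Theory Num.Theory.
Import numFieldNormedType.Exports.
Local Open Scope classical_set_scope.
Local Open Scope ring_scope.

Set Implicit Arguments.
Unset Strict Implicit.
Unset Printing Implicit Defensive.

Lemma cvg_sum_fin {R : realType} {T : Type} {J : finType} (F : set_system T)
    (f : J -> T -> R) (l : J -> R) : Filter F ->
  (forall j, f j x @[x --> F] --> l j) ->
  \sum_j f j x @[x --> F] --> \sum_j l j.
Proof.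
by move=> FF H; apply: cvg_big => //; exact: add_continuous.
Qed.

(** * Paths extended to the real line: total mass, left limits and jumps *)

Section PathExt.
Context {R : realType} {I : finType}.
Implicit Types (p : cadlag_path R I) (a : absorbing I) (s t u v : R).

(** The function G of the overview. Defining it on the whole line lets times be shifted freely
    across 0 and 1. *)
Definition ext_total p t : R := \sum_a path_ext p a t.

Definition left_lim p a t : R := lim (path_ext p a s @[s --> t^'-]).

Lemma path_extE p a t : t \in `[0, 1] -> path_ext p a t = p t a.
Proof.
by rewrite in_itv/= => /andP[t0 t1]; rewrite /path_ext ltNge t0/= min_l.
Qed.

Lemma path_ext_lt0 p a t : t < 0 -> path_ext p a t = 0.
Proof. by rewrite /path_ext => ->. Qed.

Lemma path_ext_ge1 p a t : 1 <= t -> path_ext p a t = path_ext p a 1.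
Proof.
by move=> t1; rewrite /path_ext !ltNge ler01 (le_trans ler01 t1)/= minxx min_r.
Qed.

Lemma path_ext_ge0 p a t : 0 <= path_ext p a t.
Proof.
rewrite -(@path_ext_lt0 p a (Num.min t 0 - 1)).
  by apply: path_ext_nondecreasing; rewrite lerBlDr ge_min lerDl ler01.
by rewrite subr_lt0 gt_min ltr01 orbT.
Qed.

Lemma path_ext_le1 p a t : path_ext p a t <= 1.
Proof.
have [t1|/ltW t1] := leP 1 t.
  rewrite path_ext_ge1// path_extE ?in_itv/= ?lexx ?ler01//.
  by have := @path_range _ _ p 1 a; rewrite !in_itv/= lexx ler01 =>
    /(_ isT)/andP[].
apply: (@le_trans _ _ (path_ext p a 1)); first exact: path_ext_nondecreasing.
rewrite path_extE ?in_itv/= ?lexx ?ler01//.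
by have := @path_range _ _ p 1 a; rewrite !in_itv/= lexx ler01 =>
  /(_ isT)/andP[].
Qed.

Lemma ext_totalE p t : t \in `[0, 1] -> ext_total p t = path_total p t.
Proof. by move=> t01; apply: eq_bigr => a _; rewrite path_extE. Qed.

Lemma ext_total_lt0 p t : t < 0 -> ext_total p t = 0.
Proof. by move=> t0; rewrite /ext_total big1// => a _;
  rewrite path_ext_lt0. Qed.

Lemma ext_total_ge1 p t : 1 <= t -> ext_total p t = ext_total p 1.
Proof. by move=> t1; apply: eq_bigr => a _; rewrite path_ext_ge1. Qed.

Lemma ext_total_ge0 p t : 0 <= ext_total p t.
Proof. by apply: sumr_ge0 => a _; exact: path_ext_ge0. Qed.

Lemma ext_total_nd p s t : s <= t -> ext_total p s <= ext_total p t.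
Proof. by move=> st; apply: ler_sum => a _; exact: path_ext_nondecreasing. Qed.

(** The increments of the other coordinates are nonnegative. Hence every coordinate is constant
    wherever the total mass is. *)
Lemma path_ext_increment_le p a s t : s <= t ->
  path_ext p a t - path_ext p a s <= ext_total p t - ext_total p s.
Proof.
move=> st; rewrite /ext_total -sumrB (bigD1 a)//= lerDl.
by apply: sumr_ge0 => b _; rewrite subr_ge0; exact: path_ext_nondecreasing.
Qed.

Lemma path_ext_const p a s t : s <= t -> ext_total p s = ext_total p t ->
  path_ext p a s = path_ext p a t.
Proof.
move=> st e; apply/eqP; rewrite eq_le path_ext_nondecreasing//=.
by rewrite -subr_le0 (le_trans (path_ext_increment_le p a st))// e subrr.
Qed.

Lemma ext_total_right_continuous p : right_continuous (ext_total p).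
Proof.
move=> t; apply: cvg_sum_fin => a; exact: path_ext_right_continuous.
Qed.

Lemma ext_total_right_near p t e : 0 < e ->
  exists2 d, 0 < d & forall s, s < t + d -> ext_total p s < ext_total p t + e.
Proof.
move=> e0; have /cvgrPdist_lt/(_ _ e0) := @ext_total_right_continuous p t.
case=> d /= d0 H; exists d => // s std.
have [st|ts] := leP s t.
  by rewrite (le_lt_trans (ext_total_nd p st))// ltrDl.
have /= := H s; rewrite ltr0_norm ?subr_lt0// => /(_ _ ts).
rewrite opprB ltrBlDl => /(_ std); rewrite distrC =>
  /(le_lt_trans (ler_norm _)).
by rewrite ltrBlDl.
Qed.

Lemma left_lim_cvg p a t : path_ext p a s @[s --> t^'-] --> left_lim p a t.
Proof.
apply: nondecreasing_at_left_is_cvgr; near=> x.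
- by move=> y z _ _; exact: path_ext_nondecreasing.
- by exists 1 => _ [y _ <-]; exact: path_ext_le1.
Unshelve. all: by end_near. Qed.

Lemma left_lim_ge p a s t : s < t -> path_ext p a s <= left_lim p a t.
Proof.
move=> st; apply: limr_ge; first exact/cvgP/left_lim_cvg.
near=> x; apply: path_ext_nondecreasing; near: x; exact: nbhs_left_ge.
Unshelve. all: by end_near. Qed.

Lemma left_lim_le p a t : left_lim p a t <= path_ext p a t.
Proof.
apply: limr_le; first exact/cvgP/left_lim_cvg.
near=> x; apply: path_ext_nondecreasing; near: x; exact: nbhs_left_le.
Unshelve. all: by end_near. Qed.

Lemma left_lim_near p a t e : 0 < e ->
  exists2 s, s < t & left_lim p a t - e < path_ext p a s.
Proof.
move=> e0; have /cvgrPdist_lt/(_ _ e0) := @left_lim_cvg p a t.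
move=> H; near t^'- => s; exists s => //.
have : `|left_lim p a t - path_ext p a s| < e by near: s.
by move/(le_lt_trans (ler_norm _)); rewrite ltrBlDr ltrBlDl.
Unshelve. all: by end_near. Qed.

Lemma path_jumpE p a t : t \in `[0, 1] ->
  path_jump p t a = path_ext p a t - left_lim p a t.
Proof. by move=> t01; rewrite path_extE. Qed.

Lemma path_jump_ge0 p a t : t \in `[0, 1] -> 0 <= path_jump p t a.
Proof. by move=> t01; rewrite path_jumpE// subr_ge0 left_lim_le. Qed.

Definition left_total p t : R := \sum_a left_lim p a t.

Lemma left_total_cvg p t : ext_total p s @[s --> t^'-] --> left_total p t.
Proof. by apply: cvg_sum_fin => a; exact: left_lim_cvg. Qed.

Lemma left_total_ge p s t : s < t -> ext_total p s <= left_total p t.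
Proof. by move=> st; apply: ler_sum => a _; exact: left_lim_ge. Qed.

Lemma left_total_le p t : left_total p t <= ext_total p t.
Proof. by apply: ler_sum => a _; exact: left_lim_le. Qed.

Lemma left_total_le_bound p t M : (forall s, s < t -> ext_total p s <= M) ->
  left_total p t <= M.
Proof.
move=> H; have /cvg_lim <- // := @left_total_cvg p t.
apply: limr_le; first exact/cvgP/left_total_cvg.
near=> x; apply: H; near: x; exact: nbhs_left_lt.
Unshelve. all: by end_near. Qed.

Lemma sum_path_jump p t : t \in `[0, 1] ->
  \sum_a path_jump p t a = ext_total p t - left_total p t.
Proof.
move=> t01; rewrite /ext_total /left_total -sumrB.
by apply: eq_bigr => a _; rewrite path_jumpE.
Qed.

(** Jumps of the coordinates are nonnegative, so they cannot cancel in the sum. *)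
Lemma S_setP p t : t \in `[0, 1] ->
  S_set p t <-> left_total p t < ext_total p t.
Proof.
move=> t01; split=> [[_ [a ja]]|lt].
  rewrite -subr_gt0 -sum_path_jump// (bigD1 a)//= ltr_pwDl//.
    by rewrite lt_neqAle eq_sym ja path_jump_ge0.
  by apply: sumr_ge0 => b _; exact: path_jump_ge0.
split=> //; apply: contrapT => H; move: lt.
rewrite -subr_gt0 -sum_path_jump// big1 ?ltxx// => a _.
by apply/eqP/negP => /negP ja; apply: H; exists a.
Qed.

End PathExt.

(** * The product law of a mixed action profile *)

Section ProfileProb.
Context {R : realType} {I : finType}.
Implicit Types (xi : I -> R) (a : profile I) (b : absorbing I) (i j : I).

Lemma sum_absorbing (F : profile I -> R) :
  \sum_(b : absorbing I) F (val b) = \sum_(a | a != all_continue I) F a.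
Proof.
have := @big_sub R 0 +%R (profile I) [pred a | a != all_continue I] F.
by move=> <-; apply: eq_bigl => a; rewrite inE.
Qed.

Lemma profile_probE xi a :
  profile_prob xi a = \prod_i (if a i then xi i else 1 - xi i).
Proof.
rewrite (bigID (fun i => a i))/=; congr (_ * _).
  by apply: eq_bigr => i ->.
by apply: eq_bigr => i /negbTE ->.
Qed.

Lemma profile_prob_ge0 xi a : mixed_profile xi -> 0 <= profile_prob xi a.
Proof.
move=> mxi; rewrite profile_probE; apply: prodr_ge0 => i _.
by have := mxi i; rewrite in_itv/= => /andP[? ?]; case: ifP => // _;
  rewrite subr_ge0.
Qed.

Lemma sum_profile_prob xi : \sum_a profile_prob xi a = 1.
Proof.
under eq_bigr do rewrite profile_probE.
rewrite -(bigA_distr_bigA (fun i (c : bool) => if c then xi i else 1 - xi i)).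
by rewrite big1// => i _; rewrite big_bool/= addrC subrK.
Qed.

Lemma sum_profile_prob_quit xi i :
  \sum_(a : profile I | a i) profile_prob xi a = xi i.
Proof.
(* The factors of the product law, with the one for player i continuing replaced by 0: distributing
   the product over the sums then keeps only the profiles in which i quits. *)
pose F j (c : bool) := if (j == i) && ~~ c then 0 else if c then xi j else 1 -
  xi j.
have FE a : \prod_j F j (a j) = if a i then profile_prob xi a else 0.
  rewrite profile_probE; case: ifP => ai.
    by apply: eq_bigr => j _; rewrite /F; case: eqP => // ->; rewrite ai.
  by rewrite (bigD1 i)//= /F eqxx ai mul0r.
rewrite big_mkcond; under eq_bigr do rewrite -FE.
rewrite -(bigA_distr_bigA F) (bigD1 i)//= big_bool big1 ?mulr1 => [|j ji].
  by rewrite /F eqxx/= addr0.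
by rewrite /F big_bool/= (negbTE ji)/= addrC subrK.
Qed.

(* A profile in which somebody quits is absorbing, so the marginals of the
   product law can be read off its absorbing part. *)
Lemma sum_absorbing_prob_quit xi i :
  \sum_(b : absorbing I | val b i) profile_prob xi (val b) = xi i.
Proof.
rewrite -[RHS]sum_profile_prob_quit [RHS]big_mkcond/= big_mkcond/=.
rewrite (sum_absorbing (fun a => if a i then profile_prob xi a else 0)).
by rewrite [RHS](bigD1 (all_continue I))//= ffunE add0r.
Qed.

Lemma sum_absorbing_prob xi : mixed_profile xi ->
  \sum_(b : absorbing I) profile_prob xi (val b) <= 1.
Proof.
move=> mxi; rewrite sum_absorbing -[leRHS](sum_profile_prob xi).
by rewrite [leRHS](bigD1 (all_continue I))//= lerDr profile_prob_ge0.
Qed.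

Lemma quit_prob_le_sum xi i : mixed_profile xi ->
  xi i <= \sum_(b : absorbing I) profile_prob xi (val b).
Proof.
move=> mxi; rewrite -{1}(sum_absorbing_prob_quit xi i).
rewrite [leRHS](bigID (fun b : absorbing I => val b i))/= lerDl.
by apply: sumr_ge0 => b _; exact: profile_prob_ge0.
Qed.

Lemma not_single_quitP b : ~ single_quit b ->
  exists i j, [/\ i != j, val b i & val b j].
Proof.
move=> nb; have [i bi] : exists i, val b i.
  apply: contrapT => H; have := valP b; case/negP; apply/eqP/ffunP => i.
  by rewrite ffunE; apply/negbTE/negP => bi; apply: H; exists i.
apply: contrapT => H; apply: nb; exists i; apply/ffunP => j; rewrite ffunE.
have [->//|ji] := eqVneq j i.
by apply/negbTE/negP => bj; apply: H; exists i, j; rewrite eq_sym ji.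
Qed.

(** Two distinct players i and j quit in b, so its probability is at most [xi i * xi j], and each
    factor is at most the total probability of absorption. *)
Lemma profile_prob_le_sqr xi b : mixed_profile xi -> ~ single_quit b ->
  profile_prob xi (val b) <=
  (\sum_(b' : absorbing I) profile_prob xi (val b')) ^+ 2.
Proof.
move=> mxi /not_single_quitP[i [j [ij bi bj]]].
have xi01 k : 0 <= xi k <= 1 by have := mxi k; rewrite in_itv.
rewrite profile_probE (bigD1 i)//= (bigD1 j)/= 1?eq_sym// bi bj mulrA expr2.
have xx : xi i * xi j <= (\sum_(b' : absorbing I) profile_prob xi (val b')) *
    (\sum_(b' : absorbing I) profile_prob xi (val b')).
  by apply: ler_pM; rewrite ?quit_prob_le_sum//; have /andP[] := xi01 i;
    have /andP[] := xi01 j.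
apply: le_trans xx; apply: ler_piMr.
  by apply: mulr_ge0; have /andP[] := xi01 i; have /andP[] := xi01 j.
apply: prodr_ile1 => k _; have /andP[x0 x1] := xi01 k.
by case: ifP => _; rewrite ?x0// subr_ge0 x1/= lerBlDr lerDl.
Qed.

End ProfileProb.

(** * Flat pieces and jumps of the total mass *)

Section Structure.
Context {R : realType} {I : finType}.
Implicit Types (p : cadlag_path R I) (a : absorbing I) (s t u v : R).

(** The content of (A.2): wherever the graph of G is above the diagonal, it stays horizontal until
    it meets the diagonal. *)
Definition total_flat p : Prop :=
  forall s t, t <= s -> s < ext_total p t -> ext_total p s = ext_total p t.

Definition total_admissible p : Prop :=
  [/\ ext_total p 1 = 1, (forall t, t <= 1 -> t <= ext_total p t) &
      total_flat p].

(** A value of G above t reached before t would persist through t by flatness, leaving no room for a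
    jump there. *)
Lemma S_set_total_before p t : total_flat p -> S_set p t ->
  forall s, s < t -> ext_total p s <= t.
Proof.
move=> fl St s st; rewrite leNgt; apply/negP => ts.
have t01 := St.1; have := (S_setP p t01).1 St; apply/negP; rewrite -leNgt.
by rewrite (fl t s (ltW st) ts); exact: left_total_ge.
Qed.

Lemma total_le1 p t : total_admissible p -> ext_total p t <= 1.
Proof.
move=> [e1 _ _]; have [/ltW t1|t1] := ltP t 1;
  last by rewrite ext_total_ge1// e1.
by rewrite -e1; exact: ext_total_nd.
Qed.

Lemma left_total_ge_id p t : (forall t, t <= 1 -> t <= ext_total p t) ->
  t <= 1 -> t <= left_total p t.
Proof.
move=> P1 t1; apply/ler_addgt0Pr => e e0; rewrite -lerBlDr.
have te : t - e < t by rewrite ltrBlDr ltrDl.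
by rewrite (le_trans _ (left_total_ge p te))// P1// (le_trans (ltW te)).
Qed.

(** Jumps start on the diagonal: the left limit is at least t by (A.1) and at most t by flatness.
    The total jump is thus G(t) - t. *)
Lemma S_set_left_total p t : (forall t, t <= 1 -> t <= ext_total p t) ->
  total_flat p -> S_set p t -> left_total p t = t.
Proof.
move=> P1 fl St; have := St.1; rewrite in_itv/= => /andP[t0 t1].
apply/eqP; rewrite eq_le left_total_ge_id// andbT.
by apply: left_total_le_bound; exact: S_set_total_before.
Qed.

Lemma S_set_lt_total p t : total_admissible p -> S_set p t -> t < ext_total p t.
Proof.
move=> [_ P1 fl] St; rewrite -{1}(S_set_left_total P1 fl St).
exact: (S_setP p St.1).1.
Qed.

Lemma S_set_lt1 p t : total_admissible p -> S_set p t -> t < 1.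
Proof.
by move=> ap St; rewrite (lt_le_trans (S_set_lt_total ap St))// total_le1.
Qed.

(** The marginals of the normalized jump recover the profile. This gives both its uniqueness and its
    continuous dependence on the time and the jump. *)
Lemma jump_profile_eq p t (xi : I -> R) : t < 1 -> jump_profile p t xi ->
  forall i, xi i = (\sum_(a : absorbing I | val a i) path_jump p t a) / (1 - t).
Proof.
move=> t1 [mxi jE] i; under eq_bigr do rewrite jE.
by rewrite -mulr_sumr sum_absorbing_prob_quit mulrAC mulfV ?mul1r// subr_eq0
  gt_eqF.
Qed.

(* [tau] is the first time when the total mass takes its value at [v]. *)
Lemma flat_start p v : total_admissible p -> 0 <= v -> v < ext_total p v ->
  exists tau, [/\ S_set p tau, tau <= v & ext_total p tau = ext_total p v].
Proof.
move=> [e1 P1 fl] v0 vlt; pose A := [set s | ext_total p v <= ext_total p s].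
have ev0 := le_lt_trans v0 vlt.
have Alb : lbound A 0.
  move=> s As; rewrite leNgt; apply/negP => s0; move: As.
  by rewrite /A/= (ext_total_lt0 p s0) leNgt ev0.
have Av : A v by rewrite /A/=.
have hA : has_inf A by split; [exists v|exists 0].
pose tau := inf A; have tauv : tau <= v by apply: ge_inf => //; exists 0.
have tau0 : 0 <= tau by apply: lb_le_inf => //; exists v.
have tlt s : s < tau -> ext_total p s < ext_total p v.
  move=> st; rewrite ltNge; apply/negP => As.
  by move: st; rewrite ltNge => /negP; apply; apply: ge_inf => //; exists 0.
(* Right continuity makes the infimum attained. *)
have etau : ext_total p tau = ext_total p v.
  apply/eqP; rewrite eq_le ext_total_nd//=; apply/ler_addgt0Pr => e e0.
  have [d d0 H] := ext_total_right_near p tau e0.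
  have [s As std] := inf_adherent d0 hA.
  exact: le_trans As (ltW (H _ std)).
exists tau; split => //.
have tau1 : tau <= 1.
  have : ext_total p v <= 1 by apply: total_le1.
  by move=> /(lt_le_trans vlt)/ltW; exact: le_trans.
have tau01 : tau \in `[0, 1] by rewrite in_itv/= tau0.
apply/S_setP => //; rewrite etau; apply: le_lt_trans vlt.
(* A value above v taken before [tau] would equal G(v) by flatness, against the minimality of [tau].
   So the left limit is at most v < G(v). *)
apply: left_total_le_bound => s st; rewrite leNgt; apply/negP => vs.
have := tlt _ st; rewrite (fl v s)// ?ltxx//.
exact: le_trans (ltW st) tauv.
Qed.

End Structure.

(** * Equivalence of (A.1)-(A.4) with the conditions stable under limits *)

Section Absorption.
Context {R : realType} {I : finType}.
Implicit Types (p : cadlag_path R I) (a : absorbing I) (s t u v : R).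

(** If all difference quotients on ]t, t + d[ were at least e, so would be their lower limit. *)
Lemma lower_derivative_ex p t a e d : path_lower_derivative p t a = 0%E ->
  0 < e -> 0 < d -> exists2 s, t < s < t + d & p s a - p t a < e * (s - t).
Proof.
move=> d0 e_gt0 d_gt0; apply: contrapT => H.
suff : (e%:E <= path_lower_derivative p t a)%E
  by rewrite d0 lee_fin leNgt e_gt0.
rewrite /path_lower_derivative limf_einfE.
apply: (@le_trans _ _ (ereal_inf [set ((p s a - p t a) / (s - t))%:E |
    s in [set s | t < s < t + d]])).
  apply: le_ereal_inf_tmp => _ [s /= ts <-]; rewrite lee_fin.
  have /andP[ts1 ts2] := ts.
  rewrite ler_pdivlMr ?subr_gt0// leNgt; apply/negP => lt; apply: H.
  by exists s.
apply: ereal_sup_ubound => /=; exists [set s | t < s < t + d] => //.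
near=> s; apply/andP; split; first by near: s; exact: nbhs_right_gt.
by near: s; apply: nbhs_right_lt; rewrite ltrDl.
Unshelve. all: by end_near. Qed.

Lemma lower_derivative_eq0 p t a : t \in `[0, 1[ ->
  (forall e d, 0 < e -> 0 < d ->
    exists2 s, t < s < t + d & p s a - p t a <= e * (s - t)) ->
  path_lower_derivative p t a = 0%E.
Proof.
rewrite in_itv/= => /andP[t0 t1] H; apply/eqP; rewrite eq_le; apply/andP; split.
  rewrite /path_lower_derivative limf_einfE; apply: ge_ereal_sup => _ [V nV <-].
  apply/lee_addgt0Pr => e e0; rewrite add0e.
  case: nV => d /= d0 dV; have [s /andP[ts std] le] := H e d e0 d0.
  apply: (@le_trans _ _ ((p s a - p t a) / (s - t))%:E).
    apply: ereal_inf_lbound; exists s => //; apply: dV => //=.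
    by rewrite ltr0_norm ?subr_lt0// opprB ltrBlDl.
  by rewrite lee_fin ler_pdivrMr// subr_gt0.
rewrite /path_lower_derivative limf_einfE.
apply: (@le_trans _ _ (ereal_inf [set ((p s a - p t a) / (s - t))%:E |
    s in [set s | t < s < 1]])).
  apply: le_ereal_inf_tmp => _ [s /= /andP[ts s1] <-]; rewrite lee_fin.
  rewrite divr_ge0// subr_ge0; last exact: ltW.
  apply: path_nondecreasing; rewrite ?in_itv/= ?t0 ?(ltW t1)//; last exact: ltW.
  by rewrite (le_trans t0 (ltW ts)) ltW.
apply: ereal_sup_ubound => /=; exists [set s | t < s < 1] => //.
near=> s; apply/andP; split; first by near: s; exact: nbhs_right_gt.
by near: s; exact: nbhs_right_lt.
Unshelve. all: by end_near. Qed.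

(** Flatness is the second half of (A.2) on S, is vacuous on T, and is read off the connected
    component elsewhere. That G stays below 1 at a jump uses (A.3): the left limit is at most t and
    the jump at most 1 - t. *)
Lemma absorption_total_admissible p : absorption_path p -> total_admissible p.
Proof.
move=> [A1 [A2 A2'] A3 A4].
have P1 t : t <= 1 -> t <= ext_total p t.
  have [t0 _|t0 t1] := ltP t 0; first by rewrite (le_trans (ltW t0))//
    ext_total_ge0.
  by rewrite ext_totalE ?A1// in_itv/= t0.
have cmp t : t \in `[0, 1] -> ~ S_set p t -> ~ T_set p t ->
    ext_total p t <= 1 /\ forall s, s \in `[0, 1] -> t <= s ->
      s < ext_total p t -> ext_total p s = ext_total p t.
  move=> t01 nS nT; have Xt : (`[0, 1] `\` (S_set p `|` T_set p)) t by split=>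
    // -[].
  have [t1 [t2 [ccE H]]] := A2 _ Xt.
  have := connected_component_refl Xt; rewrite ccE => tt /=.
  have et : ext_total p t = t2 by rewrite ext_totalE// H.
  rewrite et; move: tt; rewrite /= in_itv/= => /andP[t1t tt2]; split.
    rewrite leNgt; apply/negP => t21.
    (* If [t2] exceeded 1, this point of the component would lie outside [0, 1]. *)
    pose y := Num.max t ((1 + t2) / 2).
    have : connected_component (`[0, 1] `\` (S_set p `|` T_set p)) t y.
      rewrite ccE/= in_itv/= lt_max t1t/= gt_max tt2/=; lra.
    move=> /connected_component_sub[/=];
      rewrite in_itv/= ge_max => /andP[_ /andP[_ h]] _.
    by clear -t21 h; lra.
  move=> s s01 ts st2; rewrite ext_totalE// H// in_itv/= st2 andbT.
  exact: lt_le_trans ts.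
have fl01 t s : t \in `[0, 1] -> s \in `[0, 1] -> t <= s -> s < ext_total p t ->
    ext_total p s = ext_total p t.
  move=> t01 s01 ts st.
  have [St|nSt] := pselect (S_set p t).
    have [_ H] := A2' _ St; rewrite !ext_totalE// H// in_itv/= ts.
    by rewrite -ext_totalE.
  have [Tt|nTt] := pselect (T_set p t).
    by move: st; rewrite ext_totalE// Tt.2 ltNge ts.
  by have [_] := cmp t t01 nSt nTt; apply.
have le1 t : t \in `[0, 1] -> ext_total p t <= 1.
  move=> t01; have := t01; rewrite in_itv/= => /andP[t0 t1].
  have [St|nSt] := pselect (S_set p t); last first.
    have [Tt|nTt] := pselect (T_set p t); first by rewrite ext_totalE// Tt.2.
    by have [] := cmp t t01 nSt nTt.
  have lt : left_total p t <= t.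
    apply: left_total_le_bound => s st; have [s0|s0] := ltP s 0.
      by rewrite ext_total_lt0.
    rewrite leNgt; apply/negP => ts; have := (S_setP p t01).1 St.
    apply/negP; rewrite -leNgt (fl01 s t)// ?(ltW st)//.
      exact: left_total_ge.
    by rewrite in_itv/= s0 (le_trans (ltW st)).
  have [xi [mxi jE]] := A3 _ St.
  have := sum_path_jump p t01; under eq_bigr do rewrite jE.
  rewrite -mulr_sumr => e.
  have : (1 - t) * (\sum_(b : absorbing I) profile_prob xi (val b)) <= (1 - t) *
    1.
    by apply: ler_wpM2l; rewrite ?subr_ge0// sum_absorbing_prob.
  rewrite e; lra.
have one01 : (1 : R) \in `[0, 1] by rewrite in_itv/= ler01 lexx.
have e1 : ext_total p 1 = 1 by apply/eqP; rewrite eq_le le1// P1.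
split => // s t ts st.
have [t0|t0] := ltP t 0.
  by move: (st); rewrite (ext_total_lt0 p t0) => /(ext_total_lt0 p) ->.
have le1' : ext_total p t <= 1 by rewrite -e1;
  have [/ltW/ext_total_nd //|/ext_total_ge1 ->//] := ltP t 1.
have s1 := lt_le_trans st le1'.
by apply: fl01 => //; rewrite in_itv/= ?(ltW s1) ?(le_trans t0 ts)// t0 ltW//
  (le_lt_trans ts).
Qed.

(** With u rather than G(u) in the square, G(v) - u dominates the size G(t) - t of every jump at a
    time t of [u, v]. *)
Definition multi_quit_quadratic p : Prop :=
  forall a, ~ single_quit a -> forall u v, 0 <= u -> u <= v -> v < 1 ->
  path_ext p a v - path_ext p a u <= (ext_total p v - u) ^+ 2 / (1 - v).

(** The jump has total size D = (1 - t) q with q the absorption probability, and the share of a is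
    at most (1 - t) q^2 = D^2 / (1 - t). *)
Lemma jump_le_sqr p t a : total_admissible p -> condA3 p -> S_set p t ->
  ~ single_quit a -> path_jump p t a <= (ext_total p t - t) ^+ 2 / (1 - t).
Proof.
move=> ap A3 St na; have [_ P1 fl] := ap; have [xi [mxi jE]] := A3 _ St.
have t1 := S_set_lt1 ap St.
have := sum_path_jump p St.1; rewrite (S_set_left_total P1 fl St).
under eq_bigr do rewrite jE; rewrite -mulr_sumr => <-.
rewrite jE exprMn mulrAC expr2 mulfK ?subr_eq0 ?gt_eqF//.
by apply: ler_wpM2l; [rewrite subr_ge0 ltW|exact: profile_prob_le_sqr].
Qed.

(* Creeping along [u, v]: the set of times up to which the mass of [a] grows at
   most [c] times as fast as the total mass contains its supremum (jumps are
   controlled by [jump_le_sqr]) and can be extended to the right of any of its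
   points (by (A.4) on T, and because all the masses are constant elsewhere). *)
Lemma absorption_multi_quit_quadratic p :
  absorption_path p -> multi_quit_quadratic p.
Proof.
move=> absp a na u v u0 uv v1.
have ap := absorption_total_admissible absp.
have [e1 P1 fl] := ap; have [_ _ A3 A4] := absp.
have euv := ext_total_nd p uv.
have uev : u <= ext_total p v by rewrite (le_trans _ euv)// P1// (le_trans uv)//
  ltW.
apply/ler_addgt0Pr => e e_gt0.
(* The first term bounds the relative share of a in each jump on [u, v]; the slack e absorbs its
   growth at times of T. The sum suffices because G(u) >= u and G(v) - G(u) <= 1. *)
pose c := (ext_total p v - u) / (1 - v) + e.
have c0 : 0 <= (ext_total p v - u) / (1 - v)
  by rewrite divr_ge0 ?subr_ge0// ltW.
have ec : e <= c by rewrite lerDr.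
suff : path_ext p a v - path_ext p a u <= c * (ext_total p v - ext_total p u).
  move/le_trans; apply.
  rewrite mulrDl expr2 lerD//.
    rewrite [leRHS]mulrAC; apply: ler_wpM2l => //.
    by rewrite lerD2l lerN2 P1// (le_trans uv)// ltW.
  have h : ext_total p v - ext_total p u <= 1.
    by rewrite lerBlDr (le_trans (total_le1 v ap))// lerDl ext_total_ge0.
  by rewrite -[leRHS]mulr1 ler_pM2l.
pose E := [set s | u <= s <= v /\
  path_ext p a s - path_ext p a u <= c * (ext_total p s - ext_total p u)].
have Eu : E u by split; rewrite ?lexx// !subrr mulr0.
have Eub s : E s -> s <= v by case=> /andP[].
have hE : has_sup E by split; [exists u|exists v => s /Eub].
pose sg := sup E.
have sgv : sg <= v by apply: ge_sup; [exists u|move=> s /Eub].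
have usg : u <= sg by apply: ub_le_sup => //; exact: hE.2.
have sg0 := le_trans u0 usg.
have sg1 : sg < 1 := le_lt_trans sgv v1.
have sg01 : sg \in `[0, 1] by rewrite in_itv/= sg0 ltW.
have Esg : E sg.
  apply: contrapT => nE.
  (* A supremum outside [E] is approached strictly from the left, so the estimate passes to the left
     limits at [sg]; the jump is added afterwards. *)
  have left d : 0 < d -> exists2 s, E s & sg - d < s < sg.
    move=> d0; have [s Es sl] := sup_adherent d0 hE; exists s => //.
    rewrite sl/= lt_neqAle ub_le_sup ?andbT//; last exact: hE.2.
    by apply/eqP => ssg; apply: nE; rewrite -ssg.
  have lb : left_lim p a sg - path_ext p a u <= c * (left_total p sg - ext_total
    p u).
    apply/ler_addgt0Pr => d d0; have [s0 s0sg H] := left_lim_near p a sg d0.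
    have sgs0 : 0 < sg - s0 by rewrite subr_gt0.
    have [s [_ Hs] /andP[]] := left _ sgs0.
    rewrite opprB addrC subrK => s0s ssg.
    have h1 := path_ext_nondecreasing p a (ltW s0s).
    have h2 : c * (ext_total p s - ext_total p u) <= c * (left_total p sg -
      ext_total p u).
      apply: ler_wpM2l; first by rewrite (le_trans _ ec)// ltW.
      by rewrite lerD2r left_total_ge.
    lra.
  apply: nE; split; first by rewrite usg.
  have jmp : path_jump p sg a <= c * (ext_total p sg - left_total p sg).
    have [Ssg|nS] := pselect (S_set p sg); last first.
      have /eqP -> : path_jump p sg a == 0.
        by apply/negP => /negP h; apply: nS; split => //; exists a.
      rewrite mulr_ge0// ?subr_ge0 ?left_total_le// (le_trans _ ec)//;
        exact: ltW.
    rewrite (le_trans (jump_le_sqr ap A3 Ssg na))//.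
    rewrite (S_set_left_total P1 fl Ssg) expr2 mulrAC.
    have h0 : 0 <= ext_total p sg - sg by rewrite subr_ge0 P1// ltW.
    apply: ler_wpM2r => //; rewrite (@le_trans _ _ ((ext_total p v - u) / (1 -
      v)))//; last first.
      by rewrite lerDl ltW.
    apply: ler_pM => //.
    - by rewrite invr_ge0 subr_ge0 ltW.
    - by rewrite lerB// ext_total_nd.
    - by rewrite lef_pV2 ?posrE ?subr_gt0// lerD2l lerN2.
  move: jmp; rewrite path_jumpE//; lra.
suff <- : sg = v by case: Esg.
apply/eqP; rewrite eq_le sgv leNgt /=; apply/negP => sgltv.
have noE s : sg < s -> E s -> False.
  move=> sgs Es; move: sgs; rewrite ltNge => /negP; apply.
  by apply: ub_le_sup => //; exact: hE.2.
case: (Esg) => _ Hsg.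
have : sg <= ext_total p sg by rewrite P1// ltW.
rewrite le_eqVlt => /predU1P[Tsg|sgl].
  have Tset : T_set p sg by split => //; rewrite -ext_totalE.
  have vsg : 0 < v - sg by rewrite subr_gt0.
  have sgn1 : sg != 1 by rewrite lt_eqF.
  have [s /andP[sgs ss]] := lower_derivative_ex (A4 sg Tset sgn1 a na) e_gt0
    vsg.
  move: ss; rewrite addrC subrK => sv.
  have s01 : s \in `[0, 1] by rewrite in_itv/= (le_trans sg0 (ltW sgs)) ltW//
    (lt_trans sv).
  rewrite -!path_extE// => H.
  apply: (noE s sgs); split; first by rewrite (le_trans usg (ltW sgs)) ltW.
  have h1 : s <= ext_total p s by rewrite P1// ltW// (lt_trans sv).
  have h2 : e * (s - sg) <= c * (ext_total p s - ext_total p sg).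
    apply: ler_pM => //; [exact: ltW|by rewrite subr_ge0 ltW|].
    by rewrite -Tsg lerD2r.
  lra.
(* Above the diagonal nothing moves before G([sg]), so [E] extends halfway there, or to v. *)
pose s := Num.min v ((sg + ext_total p sg) / 2).
have sgs : sg < s by rewrite lt_min sgltv/=; lra.
have es : ext_total p s = ext_total p sg.
  apply: fl; first exact: ltW.
  by rewrite gt_min; apply/orP; right; lra.
apply: (noE s sgs); split; first by rewrite (le_trans usg (ltW sgs))/= ge_min
  lexx.
by rewrite es -(path_ext_const a (ltW sgs) (esym es)).
Qed.

(** Take a nearby s0 > t. If G(s0) > s0, then G keeps this value until time G(s0), and a time at
    least halfway from t to G(s0) satisfies the bound. *)
Lemma T_set_right p t d : total_admissible p -> 0 <= t -> t < 1 ->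
  ext_total p t = t -> 0 < d ->
  exists2 s, t < s < t + d & s < 1 /\ ext_total p s - t <= 2 * (s - t).
Proof.
move=> ap t0 t1 et d0; have [_ P1 fl] := ap.
pose e := Num.min d (1 - t).
have e0 : 0 < e by rewrite lt_min d0 subr_gt0.
have ed : e <= d by rewrite ge_min lexx.
have e1 : e <= 1 - t by rewrite ge_min lexx orbT.
have [d' d'0 H] := ext_total_right_near p t e0.
pose s0 := t + Num.min d' e / 2.
have m0 : 0 < Num.min d' e by rewrite lt_min d'0.
have md' : Num.min d' e <= d' by rewrite ge_min lexx.
have me : Num.min d' e <= e by rewrite ge_min lexx orbT.
have ts0 : t < s0 by rewrite /s0; lra.
have := H s0; rewrite /s0 et; have -> : t + Num.min d' e / 2 < t + d' by lra.
move=> /(_ isT); rewrite -/s0 => Hs0.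
have s0e : s0 < t + e by rewrite /s0; lra.
have : s0 <= ext_total p s0 by apply: P1; lra.
rewrite le_eqVlt => /predU1P[es0|lt].
  by exists s0; [rewrite ts0/=; lra|split; [lra|rewrite -es0; lra]].
pose s := Num.max s0 ((t + ext_total p s0) / 2).
have s0s : s0 <= s by rewrite le_max lexx.
have s2 : (t + ext_total p s0) / 2 <= s by rewrite le_max lexx orbT.
have sl : s < ext_total p s0 by rewrite gt_max lt/=; lra.
have es := fl _ _ s0s sl.
by exists s; [apply/andP; split; lra|split; [lra|rewrite es; lra]].
Qed.

(** Off S and T, the component of x runs from the jump that produced the value G(x) to the time
    G(x). For (A.4), the quadratic bound at the times of [T_set_right] makes the increment of a of
    order (s - t)^2. *)
Lemma admissible_absorption p : total_admissible p -> condA3 p ->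
  multi_quit_quadratic p -> absorption_path p.
Proof.
move=> ap A3 P4; have [e1 P1 fl] := ap.
split => //.
- move=> t t01; rewrite -ext_totalE// P1//.
  by move: t01; rewrite in_itv/= => /andP[].
- split; last first.
    move=> t St; rewrite -ext_totalE ?St.1//; split;
      first exact: S_set_lt_total.
    move=> s s01; rewrite in_itv/= -ext_totalE// => /andP[ts st]; exact: fl.
  move=> x Xx; have [x01 nST] := Xx.
  have := x01; rewrite /= in_itv/= => /andP[x0 x1].
  have xl : x < ext_total p x.
    rewrite lt_neqAle P1// andbT; apply/eqP => xe; apply: nST; right;
      split => //.
    by rewrite -ext_totalE.
  pose t2 := ext_total p x.
  have t2le : t2 <= 1 by exact: total_le1.
  have [tau [Stau taux etau]] := flat_start ap x0 xl.
  have taultx : tau < x.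
    by rewrite lt_neqAle taux andbT; apply/eqP => tx; apply: nST; left;
      rewrite -tx.
  have tau0 : 0 <= tau by have := Stau.1; rewrite in_itv/= => /andP[].
  have const s : tau <= s -> s < t2 -> ext_total p s = t2.
    by move=> ts st; rewrite (fl s tau) ?etau.
  have notS s : tau < s -> s < t2 -> ~ S_set p s.
    move=> ts st Ss; have := S_set_total_before fl Ss ts.
    by rewrite etau leNgt st.
  (* Either G(t2) = t2, or the value G(t2) > t2 was produced by a jump; that jump is at t2 itself,
     as G is at most t2 before. *)
  have St2 : S_set p t2 \/ T_set p t2.
    have t20 : 0 <= t2 := le_trans x0 (ltW xl).
    have : t2 <= ext_total p t2 by exact: P1.
    rewrite le_eqVlt => /predU1P[et2|lt2].
      by right; split; rewrite -?ext_totalE ?in_itv/= ?t20.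
    have [tau' [Stau' tau't2 etau']] := flat_start ap t20 lt2; left.
    suff <- : tau' = t2 by [].
    apply/eqP; rewrite eq_le tau't2 leNgt/=; apply/negP => h.
    have := const (Num.max tau tau'); rewrite le_max lexx gt_max h (lt_trans
      taultx xl)/=.
    move=> /(_ isT isT) h'; move: lt2; rewrite -[X in X < _]h' -etau' ltNge =>
      /negP; apply.
    by rewrite ext_total_nd// le_max lexx orbT.
  exists tau, t2; split; last first.
    move=> s; rewrite in_itv/= => /andP[ts st2].
    rewrite -ext_totalE ?const//; first exact: ltW.
    by rewrite in_itv/= (le_trans tau0 (ltW ts)) (le_trans (ltW st2)).
  have subX : `]tau, t2[ `<=` `[0, 1] `\` (S_set p `|` T_set p).
    move=> s /=; rewrite in_itv/= => /andP[ts st2].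
    have s01 : s \in `[0, 1] by rewrite in_itv/= (le_trans tau0 (ltW ts))
      (le_trans (ltW st2)).
    split => //= -[Ss|[_ Ts]]; first exact: (notS s).
    by have := const s (ltW ts) st2; rewrite ext_totalE// Ts => st2';
      move: st2; rewrite st2' ltxx.
  have xin : `]tau, t2[%classic x by rewrite /= in_itv/= taultx.
  apply/seteqP; split; last first.
    by apply: connected_component_max => //; apply/connected_intervalP;
      exact: interval_is_interval.
  move=> y [C [Cx CX Cc] Cy].
  (* A connected set through x that leaves ]tau, t2[ is an interval containing [tau] or [t2], both
     in S or T. *)
  have Ci := (connected_intervalP C).1 Cc.
  rewrite /= in_itv/=; apply/andP; split; rewrite ltNge; apply/negP => h.
    have Ctau : C tau by apply: (Ci _ _ Cy Cx); rewrite h ltW.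
    by have [_] := CX _ Ctau; apply; left.
  have Ct2 : C t2 by apply: (Ci _ _ Cx Cy); rewrite h ltW.
  by have [_] := CX _ Ct2; apply; case: St2; [left|right].
- move=> t [t01 et] t1 a na.
  have := t01; rewrite in_itv/= => /andP[t0 t1'].
  have {t1 t1'}t1 : t < 1 by rewrite lt_neqAle t1.
  rewrite -ext_totalE// in et.
  apply: lower_derivative_eq0; first by rewrite in_itv/= t0.
  move=> e d e_gt0 d_gt0.
  (* Here 4 is the square of the factor 2 in [T_set_right], and s - t <= (1 - t) / 2 gives 1 - s >=
     (1 - t) / 2. *)
  pose k := 4 / ((1 - t) / 2).
  have k0 : 0 < k by rewrite divr_gt0 ?divr_gt0// subr_gt0.
  pose d' := Num.min d (Num.min ((1 - t) / 2) (e / k)).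
  have d'0 : 0 < d' by rewrite !lt_min d_gt0 !divr_gt0// subr_gt0.
  have d'd : d' <= d by rewrite ge_min lexx.
  have d't : d' <= (1 - t) / 2 by rewrite !ge_min lexx orbT.
  have d'e : d' <= e / k by rewrite !ge_min lexx !orbT.
  have [s /andP[ts sd] [s1 es]] := T_set_right ap t0 t1 et d'0.
  exists s; first by rewrite ts/=; lra.
  have s01 : s \in `[0, 1] by rewrite in_itv/= (le_trans t0 (ltW ts)) ltW.
  rewrite -!path_extE//; apply: (le_trans (P4 a na t s t0 (ltW ts) s1)).
  have h0 : 0 <= ext_total p s - t.
    by rewrite subr_ge0 (le_trans (ltW ts))// P1// ltW.
  have st0 : 0 < s - t by rewrite subr_gt0.
  have h1 : (ext_total p s - t) ^+ 2 <= 4 * (s - t) ^+ 2.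
    rewrite (_ : 4 * (s - t) ^+ 2 = (2 * (s - t)) ^+ 2); last by ring.
    by rewrite ler_sqr ?nnegrE// mulr_ge0// ltW.
  have h2 : (ext_total p s - t) ^+ 2 / (1 - s) <= 4 * (s - t) ^+ 2 / ((1 - t) /
    2).
    apply: ler_pM => //; first exact: sqr_ge0.
      by rewrite invr_ge0 subr_ge0 ltW.
    rewrite lef_pV2 ?posrE ?divr_gt0// ?subr_gt0//; lra.
  apply: (le_trans h2).
  rewrite (_ : _ / _ = k * (s - t) * (s - t)); last by rewrite /k expr2; ring.
  rewrite ler_pM2r// -ler_pdivlMl// mulrC; lra.
Qed.

End Absorption.

(** * Passage to the limit: stable conditions and jumps *)

Section Limit.
Context {R : realType} {I : finType}.
Implicit Types (p : cadlag_path R I) (a : absorbing I) (s t u v : R).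

(* Convergence in Levy's sense, up to arbitrarily small shifts of time; unlike
   pointwise convergence it needs no care about discontinuities. *)
Definition levy_cvg (pk : nat -> cadlag_path R I) p : Prop :=
  forall a u v e, u < v -> 0 < e -> \forall k \near \oo,
    path_ext p a u - e <= path_ext (pk k) a v /\
    path_ext (pk k) a u <= path_ext p a v + e.

Variables (pk : nat -> cadlag_path R I) (p : cadlag_path R I).
Hypothesis pkp : levy_cvg pk p.

Lemma levy_cvg_total u v e : u < v -> 0 < e -> \forall k \near \oo,
  ext_total p u - e <= ext_total (pk k) v /\
  ext_total (pk k) u <= ext_total p v + e.
Proof.
move=> uv e0; pose n := #|{: absorbing I}|.
(* The successor keeps the divisor positive even when there is no absorbing profile. *)
have n0 : 0 < e / n.+1%:R by rewrite divr_gt0.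
have sume : \sum_(a : absorbing I) e / n.+1%:R <= e.
  rewrite sumr_const -(mulr_natr (e / n.+1%:R)) mulrAC ler_pdivrMr// ler_pM2l//
    ler_nat.
  exact: leqW.
have near_all : \forall k \near \oo, forall a,
    path_ext p a u - e / n.+1%:R <= path_ext (pk k) a v /\
    path_ext (pk k) a u <= path_ext p a v + e / n.+1%:R.
  by apply: filter_forall => a; exact: pkp.
apply: filterS near_all => k H; split.
  apply: (@le_trans _ _ (\sum_a (path_ext p a u - e / n.+1%:R))).
    by rewrite sumrB lerD2l lerN2.
  by apply: ler_sum => a _; case: (H a).
apply: (@le_trans _ _ (\sum_a (path_ext p a v + e / n.+1%:R))).
  by apply: ler_sum => a _; case: (H a).
by rewrite big_split lerD2l.
Qed.

Hypothesis apk : forall k, total_admissible (pk k).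

(** Each property is applied to pi^k at slightly shifted times, and right continuity of G removes
    the shifts. At time 1 the shift goes to time 2, where the extended paths still have their value
    at 1. *)
Lemma levy_cvg_admissible : total_admissible p.
Proof.
have e1 : ext_total p 1 = 1.
  have e2 k : ext_total (pk k) 2 = 1 by rewrite ext_total_ge1 ?ler1n//;
    case: (apk k).
  have e1 k : ext_total (pk k) 1 = 1 by case: (apk k).
  have l12 : (1 : R) < 2 by rewrite ltr1n.
  apply/eqP; rewrite eq_le; apply/andP; split; apply/ler_addgt0Pr => e e0.
    have [k []] := filter_ex (levy_cvg_total l12 e0).
    by rewrite e2 lerBlDr.
  have [k []] := filter_ex (levy_cvg_total l12 e0).
  by rewrite e1 (@ext_total_ge1 _ _ p 2) ?ler1n.
have P1 t : t <= 1 -> t <= ext_total p t.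
  rewrite le_eqVlt => /predU1P[->|t1]; first by rewrite e1.
  apply/ler_addgt0Pr => e e0.
  have e20 : 0 < e / 2 by rewrite divr_gt0.
  have [d d0 H] := ext_total_right_near p t e20.
  pose d' := Num.min d (1 - t).
  have d'0 : 0 < d' by rewrite lt_min d0 subr_gt0.
  have d'd : d' <= d by rewrite ge_min lexx.
  have d't : d' <= 1 - t by rewrite ge_min lexx orbT.
  have lt : t + d' / 4 < t + d' / 2 by lra.
  have [k [_ h]] := filter_ex (levy_cvg_total lt e20).
  have [_ Pk1 _] := apk k.
  have h1 : t + d' / 4 <= ext_total (pk k) (t + d' / 4) by apply: Pk1; lra.
  have h2 : ext_total p (t + d' / 2) < ext_total p t + e / 2 by apply: H; lra.
  lra.
split=> // s t ts st; apply/eqP; rewrite eq_le (ext_total_nd p ts) andbT.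
apply/ler_addgt0Pr => e e0.
have e40 : 0 < e / 4 by rewrite divr_gt0.
have [d d0 H] := ext_total_right_near p t e40.
(* Just after t, some G_k exceeds [w], so G_k is flat from there to [w]; this bounds G(s) by G(t) up
   to e. *)
pose w := (s + ext_total p t) / 2.
have sw : s < w by rewrite /w; lra.
have wlt : w < ext_total p t by rewrite /w; lra.
pose m := Num.min d (w - t).
have m0 : 0 < m by rewrite lt_min d0/= subr_gt0 (le_lt_trans ts).
have md : m <= d by rewrite ge_min lexx.
have mw : m <= w - t by rewrite ge_min lexx orbT.
have tu : t < t + m / 4 by lra.
have uv : t + m / 4 < t + m / 2 by lra.
have w0 : 0 < (ext_total p t - w) / 2 by rewrite divr_gt0// subr_gt0.
have [k [[[h1 _] [_ h2]] [h3 _]]] := filter_ex (filterI (filterI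
  (levy_cvg_total tu w0) (levy_cvg_total uv e40)) (levy_cvg_total sw e40)).
have [_ _ flk] := apk k.
have eqw : ext_total (pk k) w = ext_total (pk k) (t + m / 4).
  by apply: flk; lra.
have h4 : ext_total p (t + m / 2) < ext_total p t + e / 4 by apply: H; lra.
lra.
Qed.

(** The bound is first obtained with u, v and G(v) replaced by larger u', v' and M. Then u'
    decreases to u by right continuity, and v' and M are let tend to v and G(v) together. *)
Lemma levy_cvg_multi_quit_quadratic :
  (forall k, multi_quit_quadratic (pk k)) -> multi_quit_quadratic p.
Proof.
move=> qk a na u v u0 uv v1.
have ap := levy_cvg_admissible.
have [_ P1 _] := ap.
pose E := ext_total p v.
have uE : u <= E by rewrite (le_trans uv)// P1// ltW.
have shifted u' v' M : u < u' -> v < v' -> v' < 1 -> E < M ->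
    path_ext p a v - path_ext p a u' <= (M - u) ^+ 2 / (1 - v').
  move=> uu' vv' v'1 EM; apply/ler_addgt0Pr => e e0.
  have e20 : 0 < e / 2 by rewrite divr_gt0.
  have M0 : 0 < (M - E) / 2 by rewrite divr_gt0// subr_gt0.
  have [d d0 H] := ext_total_right_near p v M0.
  pose m := Num.min d (v' - v).
  have m0 : 0 < m by rewrite lt_min d0 subr_gt0.
  have md : m <= d by rewrite ge_min lexx.
  have mv : m <= v' - v by rewrite ge_min lexx orbT.
  pose v1' := v + m / 4.
  have vv1 : v < v1' by rewrite /v1'; lra.
  have v12 : v1' < v + m / 2 by rewrite /v1'; lra.
  pose u1 := u + Num.min (u' - u) (v1' - u) / 2.
  have min0 : 0 < Num.min (u' - u) (v1' - u) by rewrite lt_min !subr_gt0 uu';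
    lra.
  have minu : Num.min (u' - u) (v1' - u) <= u' - u by rewrite ge_min lexx.
  have minv : Num.min (u' - u) (v1' - u) <= v1' - u by rewrite ge_min lexx orbT.
  have u1u' : u1 < u' by rewrite /u1; lra.
  have uu1 : u < u1 by rewrite /u1; lra.
  have u1v1 : u1 <= v1' by rewrite /u1; lra.
  have [k [[[h1 _] [_ h2]] [_ h3]]] := filter_ex (filterI (filterI
    (pkp a vv1 e20) (pkp a u1u' e20)) (levy_cvg_total v12 M0)).
  have h4 : ext_total p (v + m / 2) < E + (M - E) / 2 by apply: H; lra.
  have v1'1 : v1' < 1 by rewrite /v1'; lra.
  have h5 := qk k a na u1 v1' (le_trans u0 (ltW uu1)) u1v1 v1'1.
  have [_ Pk1 _] := apk k.
  have h6 : v1' <= ext_total (pk k) v1' by apply: Pk1; lra.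
  have h7 : (ext_total (pk k) v1' - u1) ^+ 2 / (1 - v1') <= (M - u) ^+ 2 / (1 -
    v').
    apply: ler_pM; [exact: sqr_ge0|by rewrite invr_ge0; lra| |].
      by rewrite ler_sqr ?nnegrE; lra.
    by rewrite lef_pV2 ?posrE; rewrite /v1'; lra.
  lra.
have right v' M : v < v' -> v' < 1 -> E < M ->
    path_ext p a v - path_ext p a u <= (M - u) ^+ 2 / (1 - v').
  move=> vv' v'1 EM; apply/ler_addgt0Pr => e e0.
  have /cvgrPdist_lt/(_ _ e0) := @path_ext_right_continuous _ _ p a u.
  move=> Hnear; near u^'+ => u'.
  have uu' : u < u' by near: u'; exact: nbhs_right_gt.
  have : `|path_ext p a u - path_ext p a u'| < e by near: u'.
  rewrite distrC => /(le_lt_trans (ler_norm _)) h.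
  have := shifted u' v' M uu' vv' v'1 EM; lra.
set A := _ - _ in right *.
rewrite ler_pdivlMr ?subr_gt0//; apply/ler_addgt0Pr => e e0.
have A0 : 0 <= A by rewrite subr_ge0 path_ext_nondecreasing.
(* For v' = v + h and M = E + h with h <= 1, clearing the denominator costs at most h [C]: the cross
   term and h^2 from the square, and [A] h from the denominator. *)
pose C := 2 * (E - u) + 1 + A.
have C0 : 0 < C by rewrite /C; lra.
pose h := Num.min (Num.min 1 ((1 - v) / 2)) (e / C).
have h0 : 0 < h by rewrite !lt_min ltr01 !divr_gt0// subr_gt0.
have h1 : h <= 1 by rewrite !ge_min lexx.
have hv : h <= (1 - v) / 2 by rewrite !ge_min lexx orbT.
have hC : h * C <= e by rewrite -ler_pdivlMr// ge_min lexx orbT.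
have := right (v + h) (E + h); rewrite !ltrDl => /(_ h0 _ h0).
have -> : v + h < 1 by lra.
move=> /(_ isT); rewrite ler_pdivlMr; last by lra.
have hh : h * h <= h by rewrite ler_piMr// ltW.
move: hC hh; rewrite /C -/E !expr2 => hC hh H.
have -> : A * (1 - v) = A * (1 - (v + h)) + A * h by ring.
have e1 : (E + h - u) * (E + h - u) = (E - u) * (E - u) + h * (2 * (E - u)) + h
  * h by ring.
have e2 : h * (2 * (E - u) + 1 + A) = h * (2 * (E - u)) + h + A * h by ring.
lra.
Unshelve. all: by end_near. Qed.

Lemma levy_cvg_jump t : S_set p t -> exists tau : nat -> R,
  [/\ \forall k \near \oo, S_set (pk k) (tau k),
      tau k @[k --> \oo] --> t &
      forall a, path_jump (pk k) (tau k) a @[k --> \oo] --> path_jump p t a].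
Proof.
move=> St; have ap := levy_cvg_admissible; have [_ P1 fl] := ap.
have t01 := St.1; have := t01; rewrite in_itv/= => /andP[t0 _].
have tlt := S_set_lt_total ap St.
pose v0 := (t + ext_total p t) / 2.
have tv0 : t < v0 by rewrite /v0; lra.
have v0t : v0 < ext_total p t by rewrite /v0; lra.
have v00 : 0 <= v0 by rewrite ltW// (le_lt_trans t0).
have above v : t < v -> \forall k \near \oo, v0 < ext_total (pk k) v.
  move=> tv; have g0 : 0 < (ext_total p t - v0) / 2 by lra.
  by have := levy_cvg_total tv g0; apply: filterS => k [h _]; lra.
have /choice[tau tauP] k : exists s, v0 < ext_total (pk k) v0 ->
    [/\ S_set (pk k) s, s <= v0 & ext_total (pk k) s = ext_total (pk k) v0].
  have [h|h] := ltP v0 (ext_total (pk k) v0).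
    by have [s hs] := flat_start (apk k) v00 h; exists s.
  (* A default for the finitely many k at which G_k has not passed [v0]. *)
  by exists 0.
have St_near : \forall k \near \oo, S_set (pk k) (tau k).
  by apply: filterS (above v0 tv0) => k /tauP[].
(* Before t the limit G is at most t, so G_k(u) eventually stays below [v0], hence below
   G_k([tau k]). *)
have tau_lt u : u < t -> \forall k \near \oo, u < tau k.
  move=> ut; have um : u < (u + t) / 2 by lra.
  have g0 : 0 < (v0 - t) / 2 by lra.
  apply: filterS (filterI (above v0 tv0) (levy_cvg_total um g0)) =>
    k [h [_ h']]; have [_ _ e] := tauP k h.
  have h'' : ext_total p ((u + t) / 2) <= t by apply: S_set_total_before => //;
    lra.
  rewrite ltNge; apply/negP => /(ext_total_nd (pk k)); lra.
(* Before its jump at [tau k], G_k is at most [tau k] <= [v0], whereas G_k(v) > [v0] eventually. *)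
have tau_le v : t < v -> \forall k \near \oo, tau k <= v.
  move=> tv; apply: filterS (filterI (above v0 tv0) (above v tv)) => k [h h'];
    have [Sk tauv0 e] := tauP k h.
  rewrite leNgt; apply/negP => vtau; have [_ _ flk] := apk k.
  have := S_set_total_before flk Sk vtau; lra.
have tau_cvg : tau k @[k --> \oo] --> t.
  apply/cvgrPdist_le => e e0.
  have te : t - e < t by lra.
  have te' : t < t + e by lra.
  apply: filterS (filterI (tau_lt _ te) (tau_le _ te')) => k [h h'].
  by rewrite ler_norml; apply/andP; split; lra.
exists tau; split => // a.
have left_ge b e : 0 < e -> \forall k \near \oo,
    left_lim p b t - e <= left_lim (pk k) b (tau k).
  move=> e0; have e20 : 0 < e / 2 by rewrite divr_gt0.
  have [s st Hs] := left_lim_near p b t e20.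
  have sm : s < (s + t) / 2 by lra.
  have mt : (s + t) / 2 < t by lra.
  apply: filterS (filterI (pkp b sm e20) (tau_lt _ mt)) => k [[h _] h'].
  have := left_lim_ge (pk k) b h'; lra.
have left_cvg : left_lim (pk k) a (tau k) @[k --> \oo] --> left_lim p a t.
  apply/cvgrPdist_le => e e0; pose n := #|{: absorbing I}|.
  pose e' := e / n.+1%:R.
  have e'0 : 0 < e' by rewrite divr_gt0.
  have te' : t < t + e' by lra.
  (* In the upper bound for coordinate a, the other coordinates lose at most [n] times [e'] and the
     sum gains at most [e']. *)
  have ne : n%:R * e' + e' = e.
    by rewrite -[X in _ + X]mul1r -mulrDl natr1 /e' mulrC mulfVK// pnatr_eq0.
  have n0 : 0 <= n%:R * e' by rewrite mulr_ge0// ltW.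
  have H1 : \forall k \near \oo, forall b,
      left_lim p b t - e' <= left_lim (pk k) b (tau k).
    by apply: filter_forall => b; exact: left_ge.
  apply: filterS (filterI (filterI H1 (tau_le _ te')) St_near) => k [[h h'] Sk].
  have [_ Pk1 flk] := apk k.
  have sumd : \sum_b (left_lim (pk k) b (tau k) - left_lim p b t) = tau k - t.
    rewrite sumrB -!/(left_total _ _) (S_set_left_total Pk1 flk Sk).
    by rewrite (S_set_left_total P1 fl St).
  have rest : - (n%:R * e') <=
      \sum_(b | b != a) (left_lim (pk k) b (tau k) - left_lim p b t).
    apply: (@le_trans _ _ (\sum_(b : absorbing I | b != a) - e')).
      rewrite sumrN lerN2 sumr_const -(mulr_natl e'); apply: ler_wpM2r;
        first exact: ltW.
      by rewrite ler_nat max_card.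
    by apply: ler_sum => b _; have := h b; lra.
  move: sumd; rewrite (bigD1 a)//=; have := h a.
  by move=> ha sumd; rewrite ler_norml; apply/andP; split; lra.
(* The limit takes the same value at t and at [w], on either side of [v0]; and pi^k has the same
   value at [tau k] as at [v0]. *)
have val_cvg : path_ext (pk k) a v0 @[k --> \oo] --> path_ext p a t.
  apply/cvgrPdist_le => e e0; pose w := (v0 + ext_total p t) / 2.
  have v0w : v0 < w by rewrite /w; lra.
  have ew : path_ext p a w = path_ext p a t.
    have tw : t <= w by rewrite /w; lra.
    by apply/esym/path_ext_const => //; apply/esym/fl => //; rewrite /w; lra.
  apply: filterS (filterI (pkp a tv0 e0) (pkp a v0w e0)) => k [[h _] [_ h']].
  by rewrite ler_norml -ew in h *; apply/andP; split; lra.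
rewrite path_jumpE//; apply: cvg_trans (cvgB val_cvg left_cvg).
apply: near_eq_cvg; apply: filterS (above v0 tv0) => k /tauP[Sk tv e].
by rewrite path_jumpE ?Sk.1// (path_ext_const a tv e).
Qed.

End Limit.

(** * Convergence of the mixed profiles at the jumps *)

Section LimitProfile.
Context {R : realType} {I : finType}.
Implicit Types (p : cadlag_path R I) (a : absorbing I) (s t u v : R).

Lemma cvg_profile_prob (xik : nat -> I -> R) (xi : I -> R) (b : profile I) :
  (forall i, xik k i @[k --> \oo] --> xi i) ->
  profile_prob (xik k) b @[k --> \oo] --> profile_prob xi b.
Proof.
move=> H; under eq_fun do rewrite profile_probE; rewrite profile_probE.
apply: cvg_big => [|i _]; first exact: mul_continuous.
by case: (b i); [exact: H|apply: cvgB; [exact: cvg_cst|exact: H]].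
Qed.

(** The limit profile is defined as the marginals of the normalized limit jump, which is continuous
    since t < 1; (A.3) for the limit follows by passing to the limit in the jump formula. *)
Lemma levy_cvg_jump_profile (pk : nat -> cadlag_path R I) p t :
  levy_cvg pk p -> (forall k, total_admissible (pk k)) ->
  (forall k, condA3 (pk k)) -> S_set p t ->
  exists (tau : nat -> R) (xik : nat -> I -> R) (xi : I -> R),
    [/\ tau k @[k --> \oo] --> t,
        forall i, xik k i @[k --> \oo] --> xi i,
        \forall k \near \oo, S_set (pk k) (tau k) /\
          jump_profile (pk k) (tau k) (xik k) &
        jump_profile p t xi].
Proof.
move=> pkp apk A3k St; have [tau [Sk tauc Jc]] := levy_cvg_jump pkp apk St.
have t1 := S_set_lt1 (levy_cvg_admissible pkp apk) St.
have /choice[xik xikP] k : exists x : I -> R,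
    S_set (pk k) (tau k) -> jump_profile (pk k) (tau k) x.
  have [S|nS] := pselect (S_set (pk k) (tau k)); last by exists (fun=> 0).
  by have [x hx] := A3k k _ S; exists x.
pose xi i := (\sum_(a : absorbing I | val a i) path_jump p t a) / (1 - t).
have xic i : xik k i @[k --> \oo] --> xi i.
  have : (\sum_(a : absorbing I | val a i) path_jump (pk k) (tau k) a) /
      (1 - tau k) @[k --> \oo] --> xi i.
    apply: cvgM.
      apply: cvg_big => [|a _]; [exact: add_continuous|exact: Jc].
    apply: cvgV; first by rewrite subr_eq0 gt_eqF.
    by apply: cvgB => //; exact: cvg_cst.
  apply: cvg_trans; apply: near_eq_cvg; apply: filterS Sk => k S.
  by rewrite (jump_profile_eq (S_set_lt1 (apk k) S) (xikP k S)).
exists tau, xik, xi; split => //.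
  by apply: filterS Sk => k S; split => //; exact: xikP.
split=> [i|a].
  rewrite in_itv/=; apply/andP; split.
    rewrite -(cvg_lim _ (xic i))//; apply: limr_ge; first exact: cvgP (xic i).
    by apply: filterS Sk => k /xikP[/(_ i)]; rewrite in_itv/= => /andP[].
  rewrite -(cvg_lim _ (xic i))//; apply: limr_le; first exact: cvgP (xic i).
  by apply: filterS Sk => k /xikP[/(_ i)]; rewrite in_itv/= => /andP[].
have c : (1 - tau k) * profile_prob (xik k) (val a) @[k --> \oo] -->
    (1 - t) * profile_prob xi (val a).
  by apply: cvgM; [apply: cvgB => //; exact: cvg_cst|exact: cvg_profile_prob].
rewrite -(cvg_lim _ c)// -(cvg_lim _ (Jc a))//.
congr (lim _); apply/seteqP; split; apply: near_eq_cvg;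
  by apply: filterS Sk => k /xikP[_ ->].
Qed.

End LimitProfile.

(** * Helly's selection theorem *)

Section Helly.
Context {R : realType}.

Lemma nbhs_prod_coord (J : choiceType) (g : prod_topology (fun _ : J => R))
    (j : J) (e : R) : 0 < e ->
  nbhs g [set h : prod_topology (fun _ : J => R) | `|g j - h j| < e].
Proof.
move=> e0; have := @proj_continuous J (fun=> R) j g _ (nbhsx_ballx (g j) _ e0).
by rewrite nbhs_simpl.
Qed.

(** The partial map [f] from a finite type lists finitely many coordinates; it will be [unpickle] on
    the codes below n. *)
Lemma nbhs_prod_finite (J : choiceType) (g : prod_topology (fun _ : J => R))
    (K : finType) (f : K -> option J) (e : R) : 0 < e ->
  nbhs g [set h : prod_topology (fun _ : J => R) |
    forall i j, f i = Some j -> `|g j - h j| < e].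
Proof.
move=> e0.
apply: (@filter_forall _ K (fun i h => forall j, f i = Some j -> `|g j - h j| <
  e)
  _ (@nbhs_filter (prod_topology (fun _ : J => R)) g)) => i.
case: (f i) => [j|]; last exact: filterE.
apply: (@filterS _ _ (@nbhs_filter (prod_topology (fun _ : J => R)) g)
  _ _ _ (nbhs_prod_coord g j e0)) => h /= H j' [<-].
exact: H.
Qed.

(** Tychonoff gives a cluster point in the cube; the n-th index is chosen beyond the previous one so
    that the coordinates with code below n are within 1 / (n + 1) of it. *)
Lemma countable_diagonal (J : countType) (x : nat -> J -> R) :
  (forall k j, x k j \in `[0, 1]) ->
  exists (phi : nat -> nat) (g : J -> R),
    (forall m n, (m < n)%N -> (phi m < phi n)%N) /\
    forall j, x (phi k) j @[k --> \oo] --> g j.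
Proof.
move=> x01; pose X : nat -> prod_topology (fun _ : J => R) := x.
have [g [_ clg]] : exists g, [set f : forall j :
  J, R | forall j, `[0, 1]%classic (f j)] g /\
    cluster (X @ \oo) g.
  have := @tychonoff J (fun=> R) (fun=> `[0, 1]%classic) (fun=>
    @segment_compact R 0 1).
  move/(_ (X @ \oo) _); apply.
  by exists 0%N => // k _ j /=; exact: x01.
have step n N : exists k, (N <= k)%N /\
    forall j, (pickle j < n)%N -> `|g j - x k j| < n.+1%:R^-1.
  have n0 : 0 < n.+1%:R^-1 :> R by rewrite invr_gt0.
  have nbhsB := nbhs_prod_finite g (fun i : 'I_n => unpickle i) n0.
  have evN : (X @ \oo) [set h | exists2 k, (N <= k)%N & h = X k].
    by exists N => // k Nk; exists k.
  have [h [[k Nk ->] H]] := clg _ _ evN nbhsB.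
  by exists k; split => // j jn; apply: (H (Ordinal jn)); exact: pickleK.
have /choice[c /= cP] nN : exists k, (nN.2 <= k)%N /\
    forall j, (pickle j < nN.1)%N -> `|g j - x k j| < nN.1.+1%:R^-1.
  exact: step.
pose phi := fix phi n := if n is m.+1 then c (n, (phi m).+1) else c (0, 0)%N.
have phiP n j : (pickle j < n)%N -> `|g j - x (phi n) j| < n.+1%:R^-1.
  by case: n => // n /=; have [_] := cP (n.+1, (phi n).+1); exact.
exists phi, g; split.
  apply: (@homo_ltn _ phi (fun m n => m < n)%N) => [? ? ?|n];
    first exact: ltn_trans.
  by have [] := cP (n.+1, (phi n).+1).
move=> j; apply/cvgrPdist_lt => e e0; near=> n.
apply: lt_trans (phiP n j _) _; first by near: n; exact: nbhs_infty_gt.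
by near: n; exact: near_infty_natSinv_lt (PosNum e0).
Unshelve. all: by end_near. Qed.

Context {I : finType}.
Implicit Types (p : cadlag_path R I) (a : absorbing I) (s t u v : R) (q r :
  rat).

(** Limits are extracted at all rational times for all coordinates at once, then regularized from
    the right. *)
Lemma helly_selection (pk : nat -> cadlag_path R I) :
  exists (p : cadlag_path R I) (phi : nat -> nat),
    (forall m n, (m < n)%N -> (phi m < phi n)%N) /\
    levy_cvg (fun k => pk (phi k)) p.
Proof.
have [] := @countable_diagonal (absorbing I * rat)%type
  (fun k j => path_ext (pk k) j.1 (ratr j.2)).
  by move=> k j; rewrite in_itv/= path_ext_ge0 path_ext_le1.
move=> phi [g' [phi_incr g'_cvg]].
have ler1q q : (1 <= ratr q :> R) = (1 <= q).
  by rewrite -[X in X <= ratr _](rmorph1 (@ratr R)) ler_rat.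
pose g a q := g' (a, q).
have gc a q : path_ext (pk (phi k)) a (ratr q) @[k --> \oo] --> g a q by exact:
  g'_cvg.
have gle a q M : (forall k, path_ext (pk (phi k)) a (ratr q) <= M) -> g a q <=
  M.
  move=> H; rewrite -(cvg_lim _ (gc a q))//; apply: limr_le;
    first exact: cvgP (gc a q).
  exact: nearW.
have g_ge0 a q : 0 <= g a q.
  rewrite -(cvg_lim _ (gc a q))//; apply: limr_ge; first exact: cvgP (gc a q).
  by apply: nearW => k; exact: path_ext_ge0.
have g_le1 a q : g a q <= 1 by apply: gle => k; exact: path_ext_le1.
have g_nd a q r : q <= r -> g a q <= g a r.
  move=> qr; apply: ler_cvg_to (gc a q) (gc a r) _; apply: nearW => k.
  by apply: path_ext_nondecreasing; rewrite ler_rat.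
have g_lt0 a q : q < 0 -> g a q = 0.
  move=> q0; apply/eqP; rewrite eq_le g_ge0 andbT; apply: gle => k.
  by rewrite path_ext_lt0// ltrq0.
have g_ge1 a q : 1 <= q -> g a q = g a 2.
  move=> q1; rewrite -(cvg_lim _ (gc a q))// -(cvg_lim _ (gc a 2))//.
  have e : (fun k => path_ext (pk (phi k)) a (ratr q)) =
           (fun k => path_ext (pk (phi k)) a (ratr 2)).
    by apply/funext => k; rewrite path_ext_ge1 ?ler1q// [RHS]path_ext_ge1
      ?ler1q.
  by rewrite e.
(* The strict inequality makes the infimum right continuous in t. *)
pose G a t := [set g a q | q in [set q | t < ratr q]].
pose f t a := inf (G a t).
have Glb a t : has_lbound (G a t) by exists 0 => _ [q _ <-].
have hG a t : has_inf (G a t).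
  split=> //; have /rat_in_itvoo[q] : t < t + 1 by rewrite ltrDl.
  by rewrite in_itv/= => /andP[tq _]; exists (g a q), q.
have fle a t q : t < ratr q -> f t a <= g a q.
  by move=> tq; apply: ge_inf => //; exists q.
have fge a t M : (forall q, t < ratr q -> M <= g a q) -> M <= f t a.
  by move=> H; apply: lb_le_inf; [exact: (hG a t).1|move=> _ [q tq <-];
    exact: H].
have gf a q t : ratr q <= t -> g a q <= f t a.
  move=> qt; apply: fge => r tr; apply: g_nd.
  by rewrite -(ler_rat R) (le_trans qt)// ltW.
have f_nd a s t : s <= t -> f s a <= f t a.
  by move=> st; apply: fge => q tq; apply: fle; exact: le_lt_trans tq.
have f_ge0 a t : 0 <= f t a by exact: fge.
have f_le1 a t : f t a <= 1.
  have [[_ [q tq _]] _] := hG a t; exact: le_trans (fle a t q tq) _.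
have f_lt0 a t : t < 0 -> f t a = 0.
  move=> t0; have /rat_in_itvoo[q] := t0; rewrite in_itv/= => /andP[tq q0].
  by apply/eqP; rewrite eq_le f_ge0 andbT -(g_lt0 a q) ?fle// -(ltrq0 R).
have f_ge1 a t : 1 <= t -> f t a = g a 2.
  move=> t1; apply/eqP; rewrite eq_le; apply/andP; split.
    have [[_ [q tq _]] _] := hG a t; rewrite -(g_ge1 a q) ?fle//.
    by rewrite -(ler1q) (le_trans t1)// ltW.
  by apply: fge => q tq; rewrite -(g_ge1 a q)// -(ler1q) (le_trans t1)// ltW.
have f_rc a t : f s a @[s --> t^'+] --> f t a.
  apply/cvgrPdist_le => e e0; have [_ [q tq <-] gq] := inf_adherent e0 (hG a t).
  near=> s; have ts : t < s by near: s; exact: nbhs_right_gt.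
  rewrite distrC ger0_norm ?subr_ge0 ?f_nd ?(ltW ts)//.
  rewrite lerBlDl (le_trans _ (ltW gq))// fle//.
have f_ll a t : cvg (f s a @[s --> t^'-]).
  apply: nondecreasing_at_left_is_cvgr; near=> x.
  - by move=> y z _ _; exact: f_nd.
  - by exists 1 => _ [y _ <-].
pose p := @CadlagPath R I f
  (fun t a _ => introT andP (conj (f_ge0 a t) (f_le1 a t)))
  (fun a s t _ _ => @f_nd a s t) (fun a t _ => f_rc a t) (fun a t _ =>
    f_ll a t).
have pE a t : path_ext p a t = f t a.
  rewrite /path_ext; case: ltP => t0; first by rewrite f_lt0.
  by have [t1|t1] := leP t 1 => //=; rewrite !f_ge1// ltW.
exists p, phi; split => // a u v e uv e0.
(* A rational time between u and v separates f at u from f at v and, by monotonicity, the same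
   values of pi^k. *)
have /rat_in_itvoo[q] := uv; rewrite in_itv/= => /andP[uq qv].
have /cvgrPdist_lt/(_ _ e0) := gc a q.
apply: filterS => k; rewrite ltr_norml => /andP[h1 h2].
have h3 := path_ext_nondecreasing (pk (phi k)) a (ltW uq).
have h4 := path_ext_nondecreasing (pk (phi k)) a (ltW qv).
have h5 := fle a u q uq; have h6 := gf a q v (ltW qv).
by rewrite !pE; split; lra.
Unshelve. all: by end_near. Qed.

End Helly.

(** * From Levy convergence to weak convergence of the measures *)

Section WeakConvergence.
Context {R : realType}.

Lemma lebesgue_stieltjes_itvoc (F : cumulative R R) (x y : R) : x <= y ->
  lebesgue_stieltjes_measure F `]x, y]%classic = (F y - F x)%:E.
Proof.
move=> xy; rewrite /lebesgue_stieltjes_measure/= /measure_extension/=.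
rewrite measurable_mu_extE/=; last exact: is_ocitv.
by rewrite wlength_itv_bnd.
Qed.

Lemma Rintegral_near_cst d (T : measurableType d) (mu :
  {measure set T -> \bar R})
    (D : set T) (f : T -> R) (c e : R) :
  measurable D -> (mu D < +oo)%E -> mu.-integrable D (EFin \o f) ->
  (forall x, D x -> `|f x - c| <= e) ->
  `|\int[mu]_(x in D) f x - c * fine (mu D)| <= e * fine (mu D).
Proof.
move=> mD Doo fi fc; rewrite -!Rintegral_cst//.
have ci r : mu.-integrable D (EFin \o cst r).
  by apply: measurable_bounded_integrable => //; exact: bounded_cst.
rewrite -RintegralB//; last exact: ci.
have fci : mu.-integrable D (EFin \o (fun x => f x - c)).
  by apply: (integrableB mD fi (ci c)).
apply: le_trans (le_normr_Rintegral mD fci) _.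
apply: le_Rintegral => //; last exact: ci.
exact: (integrable_abse fci).
Qed.

(** Heine's theorem, from the near-covering form of compactness. *)
Lemma uniformly_continuous_itv (f : R -> R) (a b e : R) :
  {within `[a, b], continuous f} -> 0 < e ->
  exists2 d, 0 < d & forall x y, x \in `[a, b] -> y \in `[a, b] ->
    `|x - y| < d -> `|f x - f y| <= e.
Proof.
move=> /subspace_continuousP cf e0.
have /compact_near_coveringP/near_covering_withinP cov :=
  @segment_compact R a b.
have near_unif : \forall d \near 0^'+, `[a, b]%classic `<=`
    (fun x => forall y, y \in `[a, b] -> `|x - y| < d -> `|f x - f y| <= e).
  apply: cov => x xab; have e20 : 0 < e / 2 by rewrite divr_gt0.
  have /cvgrPdist_lt/(_ _ e20) := cf x xab.
  rewrite near_withinE/= => -[r /= r0 H].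
  have r20 : 0 < r / 2 by rewrite divr_gt0.
  near=> x' d => /= x'ab y yab xy.
  have xx' : `|x - x'| < r / 2 by near: x'; exact: nbhsx_ballx.
  have dr : d < r / 2 by near: d; exact: nbhs_right_lt.
  have xy' : `|x - y| < r.
    rewrite (le_lt_trans (ler_distD x' _ _))// [ltRHS]splitr ltrD//.
    exact: lt_trans dr.
  have hx' : `|f x - f x'| < e / 2.
    by apply: H => //=; rewrite (lt_trans xx')// ltr_pdivrMr// ltr_pMr// ltr1n.
  have hy : `|f x - f y| < e / 2 by apply: H.
  rewrite (le_trans (ler_distD (f x) _ _))// [leRHS]splitr lerD// ?ltW//.
  by rewrite distrC.
near (0 : R)^'+ => d; exists d.
  by near: d; exact: nbhs_right_gt.
move=> x y xab yab xy.
have H : `[a, b]%classic `<=`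
    (fun x => forall y, y \in `[a, b] -> `|x - y| < d -> `|f x - f y| <= e).
  by near: d.
exact: H.
Unshelve. all: by end_near. Qed.

Context {I : finType}.
Implicit Types (p : cadlag_path R I) (a : absorbing I) (s t u v x y : R).

Let mu p a : {measure set (measurableTypeR R) -> \bar R} :=
  lebesgue_stieltjes_measure (path_ext p a).

Let measurable_itvR (i : interval R) : measurable ([set` i] :
  set (measurableTypeR R)).
Proof. exact: measurable_itv. Qed.

(** The mass at 0 is captured by starting at -1: ]-1, 0[ is null, being covered by countably many
    intervals on which the extended path vanishes. *)
Lemma lebesgue_stieltjes_path_itvcc p a x : 0 <= x ->
  mu p a `[0, x]%classic = (path_ext p a x)%:E.
Proof.
move=> x0; have N10 : (-1 : R) < 0 by rewrite ltrN10.
have N1x : -1 <= x by rewrite (le_trans _ x0)// ltW.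
have neg0 : mu p a `]-1, 0[%classic = 0%E.
  apply: measure_negligible; first exact: measurable_itvR.
  apply: (@negligibleS _ (measurableTypeR R) _ (mu p a)
    (\bigcup_n `](-1 : R), (- n.+1%:R^-1)]%classic)).
    move=> y /=; rewrite in_itv/= => /andP[y1 y0].
    have y0' : 0 < - y by rewrite oppr_gt0.
    near \oo => n; exists n => //=; rewrite in_itv/= y1/= lerNr ltW//.
    by near: n; exact: (near_infty_natSinv_lt (PosNum y0')).
  apply: negligible_bigcup => n; apply/negligibleP;
    first exact: measurable_itvR.
  rewrite [LHS]lebesgue_stieltjes_itvoc; last first.
    by rewrite lerN2 invf_le1// ler1n.
  by rewrite /= !path_ext_lt0 ?subrr// oppr_lt0 invr_gt0.
have : mu p a `](-1)%R, x]%classic =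
    (mu p a `](-1)%R, 0%R[%classic + mu p a `[0%R, x]%classic)%E.
  rewrite -measureU; [|exact: measurable_itvR|exact: measurable_itvR|].
    by congr (mu p a _); rewrite -itv_bndbnd_setU//= bnd_simp// ltW.
  apply/seteqP; split => // y /= []; rewrite !in_itv/= =>
    /andP[_ y0] /andP[y0' _].
  by move: y0; rewrite ltNge y0'.
rewrite neg0 add0e => <-; rewrite [LHS]lebesgue_stieltjes_itvoc//=.
by rewrite (path_ext_lt0 p a N10) subr0.
Unshelve. all: by end_near. Qed.

Lemma lebesgue_stieltjes_path_itvoc p a x y : x <= y ->
  mu p a `]x, y]%classic = (path_ext p a y - path_ext p a x)%:E.
Proof. exact: lebesgue_stieltjes_itvoc. Qed.

Lemma path_integrable p a (f : R -> R) : {within `[0, 1], continuous f} ->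
  (mu p a).-integrable `[0, 1]%classic (EFin \o f).
Proof.
move=> cf; apply: measurable_bounded_integrable.
- exact: measurable_itvR.
- by rewrite lebesgue_stieltjes_path_itvcc ?ltry.
- by apply: measurable_realfun.subspace_continuous_measurable_fun => //;
  exact: measurable_itv.
- have /compact_bounded[M [_ mrt]] := continuous_compact cf (@segment_compact R
  0 1).
  by exists M; split; rewrite ?num_real// => ? ? ? ?; exact: mrt.
Qed.

Lemma path_integral_near_cst0 p a (f : R -> R) (c e x : R) :
  {within `[0, 1], continuous f} -> x \in `[0, 1] ->
  (forall y, y \in `[0, x] -> `|f y - c| <= e) ->
  `|\int[mu p a]_(y in `[0, x]) f y - c * path_ext p a x| <= e * path_ext p a x.
Proof.
rewrite in_itv/= => cf /andP[x0 x1] H.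
have E := lebesgue_stieltjes_path_itvcc p a x0.
have := @Rintegral_near_cst _ _ (mu p a) `[0, x]%classic f c e.
rewrite [X in fine X]E/=; apply => //; first by rewrite E ltry.
apply: integrableS (path_integrable p a cf) => //.
by apply: subset_itvl; rewrite bnd_simp.
Qed.

Lemma path_integral_near_cst p a (f : R -> R) (c e x y : R) :
  {within `[0, 1], continuous f} -> 0 <= x -> x <= y -> y <= 1 ->
  (forall z, z \in `]x, y] -> `|f z - c| <= e) ->
  `|\int[mu p a]_(z in `]x, y]) f z - c * (path_ext p a y - path_ext p a x)|
    <= e * (path_ext p a y - path_ext p a x).
Proof.
move=> cf x0 xy y1 H.
have E := lebesgue_stieltjes_path_itvoc p a xy.
have := @Rintegral_near_cst _ _ (mu p a) `]x, y]%classic f c e.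
rewrite [X in fine X]E/=; apply => //; first by rewrite E ltry.
apply: integrableS (path_integrable p a cf) => //.
by apply: subset_itv; rewrite bnd_simp.
Qed.

Lemma path_integral_split p a (f : R -> R) (x y : R) :
  {within `[0, 1], continuous f} -> 0 <= x -> x <= y -> y <= 1 ->
  \int[mu p a]_(z in `[0, y]) f z =
  \int[mu p a]_(z in `[0, x]) f z + \int[mu p a]_(z in `]x, y]) f z.
Proof.
move=> cf x0 xy y1; rewrite -Rintegral_setU.
- by rewrite -itv_bndbnd_setU// bnd_simp.
- exact: measurable_itvR.
- exact: measurable_itvR.
- apply: integrableS (path_integrable p a cf) => //.
    by apply: measurableU; exact: measurable_itvR.
  rewrite -itv_bndbnd_setU// ?bnd_simp//.
  by apply: subset_itvl; rewrite bnd_simp.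
- apply/disj_setPLR => z /=; rewrite !in_itv/= => /andP[_ zx] /andP[xz _].
  by move: xz; rewrite ltNge zx.
Qed.

(** A monotone function has countably many discontinuities, a Lebesgue null set, whereas ]x, y[ has
    positive length. *)
Lemma path_continuity_point p a x y : x < y ->
  exists2 z, x < z < y & left_lim p a z = path_ext p a z.
Proof.
move=> xy; apply: contrapT => H.
have ndF : {in `[x, y] &, nondecreasing_fun (path_ext p a)}.
  by move=> s t _ _; exact: path_ext_nondecreasing.
have := countable_lebesgue_measure0 (discontinuity_countable ndF).
have -> : [set z | z \in (`]x, y[) /\ discontinuity (path_ext p a) z] = `]x,
  y[%classic.
  apply/seteqP; split => z /=; first by case.
  move=> zxy; split => //; split.
  - exact/cvgP/left_lim_cvg.
  - exact/cvgP/path_ext_right_continuous.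
  - apply/eqP => e; apply: H; exists z; first by rewrite in_itv/= in zxy.
    rewrite [LHS]e; apply/cvg_lim => //; exact: path_ext_right_continuous.
rewrite lebesgue_measure_itv/= lte_fin xy => /eqP.
by rewrite -EFinD eqe subr_eq0 gt_eqF.
Qed.

Variables (pk : nat -> cadlag_path R I) (p : cadlag_path R I).
Hypothesis pkp : levy_cvg pk p.

Lemma levy_cvg_continuity_point a z : left_lim p a z = path_ext p a z ->
  path_ext (pk k) a z @[k --> \oo] --> path_ext p a z.
Proof.
move=> lz; apply/cvgrPdist_le => e e0; have e20 : 0 < e / 2 by rewrite divr_gt0.
have [s sz Hs] := left_lim_near p a z e20.
have /cvgrPdist_lt/(_ _ e20) near_z := @path_ext_right_continuous _ _ p a z.
near z^'+ => u; have zu : z < u by near: u; exact: nbhs_right_gt.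
have : `|path_ext p a z - path_ext p a u| < e / 2 by near: u.
rewrite ltr_norml => /andP[hu _].
apply: filterS (filterI (pkp a sz e20) (pkp a zu e20)) => k [[h _] [_ h']].
by rewrite ler_norml; apply/andP; split; lra.
Unshelve. all: by end_near. Qed.

(** Time 1 may be a discontinuity; the comparison is with time 2, where the extended paths have the
    same value. *)
Lemma levy_cvg_at1 a : path_ext (pk k) a 1 @[k --> \oo] --> path_ext p a 1.
Proof.
apply/cvgrPdist_le => e e0; have l12 : (1 : R) < 2 by rewrite ltr1n.
have E (q : cadlag_path R I) : path_ext q a 2 = path_ext q a 1
  by rewrite path_ext_ge1// ltW.
apply: filterS (pkp a l12 e0) => k [h h']; rewrite !E in h h' *.
by rewrite ler_norml; apply/andP; split; lra.
Qed.

(* Riemann-Stieltjes sums along a mesh of continuity points, by induction on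
   the number of mesh cells needed to reach [x]. *)
Lemma levy_cvg_integral_itv a (f : R -> R) (e d : R) :
  {within `[0, 1], continuous f} -> 0 < e -> 0 < d ->
  (forall x y, x \in `[0, 1] -> y \in `[0, 1] -> `|x - y| < d ->
    `|f x - f y| <= e) ->
  forall n x, x \in `[0, 1] -> x < d / 2 * n.+2%:R ->
  path_ext (pk k) a x @[k --> \oo] --> path_ext p a x ->
  forall h, 0 < h -> \forall k \near \oo,
    `|\int[mu (pk k) a]_(y in `[0, x]) f y - \int[mu p a]_(y in `[0, x]) f y| <=
    e * (path_ext (pk k) a x + path_ext p a x) + h.
Proof.
move=> cf e0 d0 unif; elim=> [|n IHn] x x01 xn cx h h0;
    have := x01; rewrite in_itv/= => /andP[x0 x1].
  (* Here x < d, so [0, x] is a single cell. *)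
  have cfx : f x * path_ext (pk k) a x @[k --> \oo] --> f x * path_ext p a x.
    by apply: cvgM => //; exact: cvg_cst.
  have /cvgrPdist_le/(_ _ h0) := cfx.
  have fx y : y \in `[0, x] -> `|f y - f x| <= e.
    rewrite in_itv/= => /andP[y0 yx]; apply: unif => //.
      by rewrite in_itv/= y0 (le_trans yx).
    rewrite distrC ger0_norm ?subr_ge0//.
    by move: xn; rewrite mulfVK//; lra.
  apply: filterS => k; have := path_integral_near_cst0 (pk k) a cf x01 fx.
  have := path_integral_near_cst0 p a cf x01 fx.
  set A := Rintegral _ _ _; set B := Rintegral _ _ _.
  rewrite !ler_norml => /andP[? ?] /andP[? ?] /andP[? ?]; apply/andP; split;
    lra.
have [xn'|xn'] := ltP x (d / 2 * n.+2%:R); first exact: IHn.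
have n2 : 2 <= n.+2%:R :> R by rewrite ler_nat.
have dx : d <= x.
  by apply: le_trans xn'; rewrite -mulrA ler_peMr ?(ltW d0)// mulrC
    ler_pdivlMr// mul1r.
(* The last cell ]y, x] is shorter than d, so f varies by at most e on it, and longer than d / 2, so
   y falls under the induction hypothesis. *)
have lt : x - d < x - d / 2 by lra.
have [y /andP[dy yd] cy] := path_continuity_point p a lt.
have y0 : 0 <= y by lra.
have yx : y <= x by lra.
have y01 : y \in `[0, 1] by rewrite in_itv/= y0; lra.
have yn : y < d / 2 * n.+2%:R.
  by move: xn; rewrite -[n.+3%:R]natr1 mulrDr mulr1; lra.
have {}cy := levy_cvg_continuity_point cy.
have h20 : 0 < h / 2 by rewrite divr_gt0.
have cfxy : f x * (path_ext (pk k) a x - path_ext (pk k) a y) @[k --> \oo] -->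
    f x * (path_ext p a x - path_ext p a y).
  by apply: cvgM; [exact: cvg_cst|exact: cvgB].
have /cvgrPdist_le/(_ _ h20) near_xy := cfxy.
have fx z : z \in `]y, x] -> `|f z - f x| <= e.
  rewrite in_itv/= => /andP[yz zx]; apply: unif => //.
    by rewrite in_itv/= (le_trans y0 (ltW yz)) (le_trans zx).
  by rewrite distrC ger0_norm ?subr_ge0//; lra.
apply: filterS (filterI (IHn y y01 yn cy _ h20) near_xy) => k [].
rewrite (path_integral_split (pk k) a cf y0 yx x1) (path_integral_split p a cf
  y0 yx x1).
have := path_integral_near_cst (pk k) a cf y0 yx x1 fx.
have := path_integral_near_cst p a cf y0 yx x1 fx.
set A := Rintegral _ _ _; set B := Rintegral _ _ _.
set A' := Rintegral _ _ _; set B' := Rintegral _ _ _.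
rewrite !ler_norml => /andP[? ?] /andP[? ?] /andP[? ?] /andP[? ?].
by apply/andP; split; lra.
Qed.

Lemma levy_cvg_weak_cvg : weak_cvg pk p.
Proof.
move=> f cf a; apply/cvgrPdist_le => e e0.
(* Both masses are at most 1, so the oscillation of f costs at most e / 2; the other half pays for
   the masses of the cells. *)
have e40 : 0 < e / 4 by rewrite divr_gt0.
have [d d0 unif] := uniformly_continuous_itv cf e40.
have [n dn] : exists n : nat, 1 < d / 2 * n.+2%:R.
  exists (Num.bound (d / 2)^-1); rewrite -ltr_pdivrMl ?divr_gt0// mulr1.
  apply: lt_le_trans (archi_boundP _) _;
    first by rewrite invr_ge0 divr_ge0// ltW.
  by rewrite ler_nat; apply: leqW; exact: leqnSn.
have one01 : (1 : R) \in `[0, 1] by rewrite in_itv/= ler01 lexx.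
have e20 : 0 < e / 2 by rewrite divr_gt0.
have := levy_cvg_integral_itv cf e40 d0 unif one01 dn (@levy_cvg_at1 a) e20.
apply: filterS => k; rewrite distrC => /le_trans; apply.
have h1 := path_ext_le1 (pk k) a 1; have h2 := path_ext_le1 p a 1.
have : e / 4 * (path_ext (pk k) a 1 + path_ext p a 1) <= e / 4 * 2.
  by rewrite ler_pM2l//; lra.
lra.
Qed.

End WeakConvergence.

(** * Sequential compactness and the approximation of jumps *)

Unset Implicit Arguments.

Theorem proposition4p9 (R : realType) (I : finType)
    (pk : nat -> cadlag_path R I)
    (hpk : forall k : nat, absorption_path (pk k)) :
  exists (p : cadlag_path R I) (phi : nat -> nat),
    [/\ absorption_path p,
        (forall m n : nat, (m < n)%N -> (phi m < phi n)%N),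
        weak_cvg (fun k : nat => pk (phi k)) p
      & forall t : R, S_set p t ->
        forall xi : I -> R, jump_profile p t xi ->
        exists (tk : nat -> R) (xik : nat -> I -> R),
          [/\ (forall k : nat, tk k \in `[0, 1]),
              tk k @[k --> \oo] --> t,
              (forall i : I, xik k i @[k --> \oo] --> xi i)
            & forall k : nat,
                S_set (pk (phi k)) (tk k) /\
                jump_profile (pk (phi k)) (tk k) (xik k)]].
Proof.
have [p [phi0 [phi0_incr levy0]]] := helly_selection pk.
have apk k : total_admissible (pk k) by exact: absorption_total_admissible.
have qpk k : multi_quit_quadratic (pk k) by exact:
  absorption_multi_quit_quadratic.
have A3k k : condA3 (pk k) by case: (hpk k).
have ap := levy_cvg_admissible levy0 (fun k => apk (phi0 k)).
(* The jump times are requested for every [k], so the finitely many paths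
   without any jump are dropped when the limit has jumps. *)
have [K HK] : exists K, (exists t, S_set p t) ->
    forall k, (K <= k)%N -> exists s, S_set (pk (phi0 k)) s.
  have [[t St]|nS] := pselect (exists t, S_set p t); last by exists 0%N.
  have [tau [[K _ HK] _ _]] := levy_cvg_jump levy0 (fun k => apk (phi0 k)) St.
  by exists K => _ k Kk; exists (tau k); exact: HK.
pose phi k := phi0 (k + K)%N.
have levy : levy_cvg (fun k => pk (phi k)) p.
  move=> a u v e uv e0; have [N _ HN] := levy0 a u v e uv e0.
  by exists N => // k /= Nk; apply: HN => /=; rewrite (leq_trans Nk)// leq_addr.
have jumps t St := levy_cvg_jump_profile levy (fun k => apk (phi k))
  (fun k => A3k (phi k)) (St : S_set p t).
exists p, phi; split.
- apply: admissible_absorption => //.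
    by move=> t /jumps[tau [xik [xi [_ _ _ Jt]]]]; exists xi.
  by apply: (levy_cvg_multi_quit_quadratic levy) => k; [exact: apk|exact: qpk].
- by move=> m n mn; apply: phi0_incr; rewrite ltn_add2r.
- exact: levy_cvg_weak_cvg.
move=> t St xi Jxi; have [tau [xik [xi' [tauc xikc nearJ Jxi']]]] := jumps t St.
have t1 := S_set_lt1 ap St.
(* The given profile is the constructed limit, by uniqueness. *)
have xiE i : xi' i = xi i.
  by rewrite (jump_profile_eq t1 Jxi) (jump_profile_eq t1 Jxi').
pose good k := S_set (pk (phi k)) (tau k) /\
  jump_profile (pk (phi k)) (tau k) (xik k).
(* At the finitely many k where the constructed pair fails, any jump of the path with a profile from
   (A.3) is taken; the limits are unaffected. *)
have /choice[f fP] k : exists z : R * (I -> R),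
    (S_set (pk (phi k)) z.1 /\ jump_profile (pk (phi k)) z.1 z.2) /\
    (good k -> z = (tau k, xik k)).
  have [gk|ngk] := pselect (good k); first by exists (tau k, xik k).
  have [s Ss] := HK (ex_intro _ t St) (k + K)%N (leq_addl _ _).
  by have [x Jx] := A3k (phi k) s Ss; exists (s, x).
exists (fun k => (f k).1), (fun k => (f k).2); split.
- by move=> k; have [[[]]] := fP k.
- apply: cvg_trans tauc; apply: near_eq_cvg.
  by apply: filterS nearJ => k gk; have [_ ->] := fP k.
- move=> i; rewrite -xiE; apply: cvg_trans (xikc i); apply: near_eq_cvg.
  by apply: filterS nearJ => k gk; have [_ ->] := fP k.
- by move=> k; have [] := fP k.
Qed.
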